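(* Let $Q$ be a quiver, let $\mathrm{Rep}(Q,\mathbf{v})$ be the space of complex representations of $Q$ with fixed dimension vector $\mathbf{v}$, let $\alpha$ be a stability parameter with $\deg_\alpha(Q,\mathbf{v})=0$, and let $d_{min}(Q,\mathbf{v},\alpha)$ be the associated minimal dimension. Then $\pi_n\left(\mathrm{Rep}(Q,\mathbf{v})^{\alpha\text{-}st}\right)=0$ for all $n<d_{min}(Q,\mathbf{v},\alpha)-1$.
   Context: A quiver $Q$ is a finite directed graph with vertex set $\mathcal{I}$, edge set $\mathcal{E}$, and head/tail maps $h,t:\mathcal{E}\to\mathcal{I}$. Fix a finite-dimensional complex vector space $V_j$ with Hermitian structure for each $j\in\mathcal{I}$; the dimension vector is $\mathbf{v}=(v_j)_{j\in\mathcal{I}}$, $v_j=\dim_{\mathbb{C}}V_j$ (not all zero), and $\mathrm{Rep}(Q,\mathbf{v})=\bigoplus_{a\in\mathcal{E}}\mathrm{Hom}(V_{t(a)},V_{h(a)})$, with its vector space topology. A subrepresentation of $A=(A_a)_{a\in\mathcal{E}}$ is a choice of subspaces $V_j'\subseteq V_j$ with $A_a(V'_{t(a)})\subseteq V'_{h(a)}$ for all $a\in\mathcal{E}$ (with the restricted maps); its dimension vector is $\mathbf{v'}=(\dim_{\mathbb{C}} V_j')_{j\in\mathcal{I}}$. A stability parameter $\alpha$ is a choice of real number $\alpha_j$ for each $j\in\mathcal{I}$ (corresponding to the central element $(\sqrt{-1}\,\alpha_j\,\mathrm{id}_{V_j})_{j}$ of $\bigoplus_j\mathfrak{u}(V_j)\cong\mathfrak{g}_{\mathbf{v}}^*$).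 For a nonzero dimension vector $\mathbf{v'}$ set $\mathrm{rank}(Q,\mathbf{v'})=\sum_j v_j'$, $\deg_\alpha(Q,\mathbf{v'})=\sum_j-\alpha_jv_j'$ and $\mathrm{slope}_\alpha(Q,\mathbf{v'})=\deg_\alpha(Q,\mathbf{v'})/\mathrm{rank}(Q,\mathbf{v'})$. It is a standing assumption that $\deg_\alpha(Q,\mathbf{v})=0$. A representation $A\in\mathrm{Rep}(Q,\mathbf{v})$ is $\alpha$-stable if every subrepresentation whose dimension vector $\mathbf{v'}$ is neither $\mathbf{0}$ nor $\mathbf{v}$ satisfies $\mathrm{slope}_\alpha(Q,\mathbf{v'})<\mathrm{slope}_\alpha(Q,\mathbf{v})$; the set of $\alpha$-stable representations is $\mathrm{Rep}(Q,\mathbf{v})^{\alpha\text{-}st}$. Write $\mathbf{v'}<\mathbf{v}$ if $0\le v_j'\le v_j$ for all $j$ and $\mathbf{v'}\ne\mathbf{0},\mathbf{v}$. For subspaces $V_j'\subseteq V_j$ of dimensions $v_j'$, let $\pi$ be the collection of orthogonal projections $\pi_j$ of $V_j$ onto $V_j'$, let $\pi^\perp=\mathrm{id}-\pi$, and set $$\mathrm{Hom}^0(\pi,\pi^\perp)=\bigoplus_{j\in\mathcal{I}}\mathrm{Hom}(\pi(V_j),\pi^\perp(V_j)),\qquad \mathrm{Hom}^1(\pi,\pi^\perp)=\bigoplus_{a\in\mathcal{E}}\mathrm{Hom}(\pi(V_{t(a)}),\pi^\perp(V_{h(a)})).$$ The number $\dim_{\mathbb{R}}\mathrm{Hom}^1(\pi,\pi^\perp)-\dim_{\mathbb{R}}\mathrm{Hom}^0(\pi,\pi^\perp)$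 depends only on $\mathbf{v'}$, and the minimal dimension is $$d_{min}(Q,\mathbf{v},\alpha)=\min_{\substack{\mathbf{v'}<\mathbf{v}\\ \mathrm{slope}_\alpha(Q,\mathbf{v'})\ge\mathrm{slope}_\alpha(Q,\mathbf{v})}}\left(\dim_{\mathbb{R}}\mathrm{Hom}^1(\pi,\pi^\perp)-\dim_{\mathbb{R}}\mathrm{Hom}^0(\pi,\pi^\perp)\right)$$ (with the minimum over the empty set being $+\infty$). Here $n\ge0$ is an integer, and $\pi_0=0$ means path-connected. *)

(* Defs.v *)
From HB Require Import structures.
From mathcomp Require Import all_boot all_order all_algebra.
From mathcomp Require Import complex.
From mathcomp Require Import all_classical all_reals all_analysis.

Set Implicit Arguments.
Unset Strict Implicit.
Unset Printing Implicit Defensive.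

Import Order.TTheory GRing.Theory Num.Theory.
Import numFieldNormedType.Exports.

Local Open Scope classical_set_scope.
Local Open Scope ring_scope.

(* R[i] itself carries no topology in the library; folded into a
   numClosedFieldType it gets the topology of its norm. *)
Definition Cplx (R : realType) : numClosedFieldType := R[i].

Record quiver := Quiver {
  vertex : finType;
  edge : finType;
  qhead : edge -> vertex;
  qtail : edge -> vertex }.

Section Slope.
Variables (R : realType) (Q : quiver).
Implicit Types (v : vertex Q -> nat) (alpha : vertex Q -> R).

Definition qrank v : nat := \sum_j v j.
Definition qdeg alpha v : R := \sum_j - alpha j * (v j)%:R.
Definition qslope alpha v : R := qdeg alpha v / (qrank v)%:R.

Definition dimv_lt (v' v : vertex Q -> nat) : Prop :=
  [/\ forall j, (v' j <= v j)%N, v' <> (fun=> 0%N) & v' <> v].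

End Slope.

(* 'Hom(V, W) with its vector space topology, i.e. the one transported from
   C^N by the coordinates in a basis (the choice of basis is immaterial). *)
Definition hom_top (R : realType) (V W : vectType (Cplx R)) : Type :=
  initial_topology
    (passmx.rVof (vbasis {: 'Hom(V, W)}) :
       'Hom(V, W) -> 'rV[Cplx R]_(\dim {: 'Hom(V, W)})).

HB.instance Definition _ (R : realType) (V W : vectType (Cplx R)) :=
  Topological.on (@hom_top R V W).

Definition Rep (R : realType) (Q : quiver) (V : vertex Q -> vectType (Cplx R)) :
    Type :=
  prod_topology (fun a : edge Q => hom_top (V (qtail a)) (V (qhead a))).

HB.instance Definition _ (R : realType) (Q : quiver)
    (V : vertex Q -> vectType (Cplx R)) :=
  Topological.on (Rep V).

Section Representations.
Variables (R : realType) (Q : quiver) (V : vertex Q -> vectType (Cplx R)).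

Definition rep_map (A : Rep V) (a : edge Q) : 'Hom(V (qtail a), V (qhead a)) :=
  A a.

Definition total_dimv : vertex Q -> nat := fun j => \dim {: V j}.

Definition sub_dimv (U : forall j, {vspace V j}) : vertex Q -> nat :=
  fun j => \dim (U j).

Definition subrep (A : Rep V) (U : forall j, {vspace V j}) : Prop :=
  forall a, (rep_map A a @: U (qtail a) <= U (qhead a))%VS.

Definition stable (alpha : vertex Q -> R) (A : Rep V) : Prop :=
  forall U : forall j, {vspace V j}, subrep A U ->
    sub_dimv U <> (fun=> 0%N) -> sub_dimv U <> total_dimv ->
    qslope alpha (sub_dimv U) < qslope alpha total_dimv.

Definition Rep_stable (alpha : vertex Q -> R) : set (Rep V) :=
  [set A | stable alpha A].

End Representations.

Definition dimR (R : realType) (V : vectType (Cplx R)) : nat :=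
  (2 * \dim {: V})%N.

Section MinimalDimension.
Variables (R : realType) (Q : quiver) (V : vertex Q -> vectType (Cplx R)).
Variable herm : forall j, {dot V j for @Num.conj (Cplx R)}.

Definition orth_proj (U : forall j, {vspace V j}) (j : vertex Q) : 'End(V j) :=
  daddv_pi (U j) (orthov (herm j) (U j)).

Definition orth_projC (U : forall j, {vspace V j}) (j : vertex Q) :
  'End(V j) := \1%VF - orth_proj U j.

Definition hom_pi (U : forall j, {vspace V j}) (i j : vertex Q) :
  vectType (Cplx R) :=
  'Hom(subvs_of (limg (orth_proj U i)), subvs_of (limg (orth_projC U j))).

Definition dimR_Hom0 (U : forall j, {vspace V j}) : nat :=
  \sum_j dimR (hom_pi U j j).
Definition dimR_Hom1 (U : forall j, {vspace V j}) : nat :=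
  \sum_a dimR (hom_pi U (qtail a) (qhead a)).

(* As dimR_Hom1 U - dimR_Hom0 U depends only on the dimension vector of U and
   there are finitely many v' < v, this infimum is a minimum over v', with
   value +oo when no v' is admissible. *)
Definition d_min (alpha : vertex Q -> R) : \bar R :=
  ereal_inf [set x | exists (v' : vertex Q -> nat) (U : forall j, {vspace V j}),
    [/\ dimv_lt v' (total_dimv V),
        qslope alpha (total_dimv V) <= qslope alpha v',
        sub_dimv U = v' &
        x = ((dimR_Hom1 U)%:R - (dimR_Hom0 U)%:R)%:E]].

End MinimalDimension.

Section HomotopyGroups.
Variables (R : realType) (T : topologicalType).
Implicit Types (n : nat) (S : set T).

Definition cube n : set 'rV[R]_n := [set t | forall i, 0 <= t ord0 i <= 1].
Definition cube_boundary n : set 'rV[R]_n :=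
  [set t | cube t /\ exists i, t ord0 i = 0 \/ t ord0 i = 1].

(* Maps (I^n, dI^n) -> (S, x0). Only the values on I^n are relevant. *)
Definition cube_loop n S (x0 : T) (f : 'rV[R]_n -> T) : Prop :=
  [/\ {within @cube n, continuous f},
      (forall t, cube t -> S (f t)) &
      (forall t, cube_boundary t -> f t = x0)].

Definition cube_homotopic n S (x0 : T) (f g : 'rV[R]_n -> T) : Prop :=
  exists H : 'rV[R]_n * R -> T,
    [/\ {within @cube n `*` `[0, 1], continuous H},
        (forall t s, cube t -> 0 <= s <= 1 -> S (H (t, s))),
        (forall t, cube t -> H (t, 0) = f t /\ H (t, 1) = g t) &
        (forall t s, cube_boundary t -> 0 <= s <= 1 -> H (t, s) = x0)].

(* pi_n(S) = 0: S is nonempty and, for each base point, pi_n has a single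
   element. I^0 is a point with empty boundary, so pi_0(S) = 0 says that S is
   path-connected. *)
Definition pi_trivial n S : Prop :=
  S !=set0 /\ forall x0, S x0 -> forall f g : 'rV[R]_n -> T,
    cube_loop S x0 f -> cube_loop S x0 g -> cube_homotopic S x0 f g.

End HomotopyGroups.

(* Main.v *)
(* The non-stable locus Z is a finite union of images of polynomial maps (charts)
   from real vector spaces of dimension at most dim Rep - d_min: after a
     choice of
   pivots every subspace V' of V is spanned by the rows indexed by the pivots
     of a
   unipotent matrix 1 + N, and the representations preserving V' are block
   triangular in the basis given by 1 + N.  Choosing the pivots with the largest
   minor keeps the entries of N bounded by 1, so that the part of Z in a ball is
   the image of compact pieces of the charts; in particular Z is closed.
   Two loops in the complement of Z are joined by an affine homotopy F in Rep.
     On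
   the cube I^(n+1), F is uniformly approximated by a Lipschitz map g.  As
   n + 1 < d_min, counting boxes shows that Z - g(I^(n+1)) contains no ball,
     hence
   a small translate g + c misses Z.  Interpolating between F and g + c, with
   weight 1 where F is close to Z and weight 0 on the boundary,
     gives a homotopy in
   the complement of Z. *)
Require Import Defs.
From mathcomp Require Import all_boot all_order all_algebra.
From mathcomp Require Import complex.
From mathcomp Require Import all_classical all_reals all_analysis.
From mathcomp Require Import ring lra.
Import Order.TTheory GRing.Theory Num.Theory.
Import numFieldNormedType.Exports.
Local Open Scope ring_scope.

Set Implicit Arguments.
Unset Strict Implicit.
Unset Printing Implicit Defensive.

(** * Lipschitz functions on boxes *)

Section Lipschitz.
Variables (R : realType) (I : finType).
Implicit Types (x y : I -> R) (f g : (I -> R) -> R).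

Definition box (r : R) x := forall i, `|x i| <= r.

(** Distances in [I -> R] are sup distances, entering only through an upper bound [d]. The constant
    is allowed to depend on the box because polynomial charts are only locally Lipschitz. *)
Definition lip r f := exists2 C, 0 <= C & forall x y d, 0 <= d ->
  box r x -> box r y -> (forall i, `|x i - y i| <= d) -> `|f x - f y| <= C * d.

Lemma lip_cst r c : lip r (fun=> c).
Proof. by exists 0 => // x y d d0 _ _ _; rewrite subrr normr0 mul0r. Qed.

Lemma lip_coord r i : lip r (fun x => x i).
Proof. by exists 1 => // x y d _ _ _ /(_ i); rewrite mul1r. Qed.

Lemma lipD r f g : lip r f -> lip r g -> lip r (fun x => f x + g x).
Proof.
move=> [C C0 fC] [D D0 gD]; exists (C + D) => [|x y d d0 bx bY xy].
  exact: addr_ge0.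
rewrite opprD addrACA mulrDl (le_trans (ler_normD _ _))// lerD//.
  exact: fC.
exact: gD.
Qed.

Lemma lip_bounded r f : lip r f ->
  exists2 M, 0 <= M & forall x, box r x -> `|f x| <= M.
Proof.
(* For [r < 0] the box is empty unless [I] is empty, and then there is a single point. *)
move=> [C C0 fC]; case: (ltP r 0) => [r0|r0].
  have [i0|I0] := pickP (xpredT : pred I); last first.
    exists `|f (fun=> 0)| => // x _; suff -> : x = (fun=> 0) by [].
    by apply/funext => i; have := I0 i.
  by exists 0 => // x /(_ i0) H; have := le_trans (normr_ge0 _) H;
    rewrite leNgt r0.
exists (`|f (fun=> 0)| + C * r) => [|x bx].
  by rewrite addr_ge0// mulr_ge0.
have b0 : box r (fun=> 0) by move=> i; rewrite normr0.
have H := fC x (fun=> 0) r r0 bx b0.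
rewrite -lerBlDl (le_trans (lerB_dist _ _))// H// => i.
by rewrite subr0.
Qed.

Lemma lipM r f g : lip r f -> lip r g -> lip r (fun x => f x * g x).
Proof.
move=> fl gl; have [M M0 fM] := lip_bounded fl.
have [N N0 gN] := lip_bounded gl.
case: fl gl => [C C0 fC] [D D0 gD].
exists (M * D + N * C) => [|x y d d0 bx bY xy].
  by rewrite addr_ge0// mulr_ge0.
have -> : f x * g x - f y * g y = f x * (g x - g y) + g y * (f x - f y) by ring.
rewrite (le_trans (ler_normD _ _))// !normrM mulrDl lerD// -mulrA.
  by apply: ler_pM => //; [exact: fM | exact: gD].
by apply: ler_pM => //; [exact: gN | exact: fC].
Qed.

Lemma lipN r f : lip r f -> lip r (fun x => - f x).
Proof.
move=> [C C0 fC]; exists C => // x y d d0 bx bY xy.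
by rewrite -opprD normrN fC.
Qed.

Lemma lip_sum r (T : finType) (F : T -> (I -> R) -> R) :
  (forall t, lip r (F t)) -> lip r (fun x => \sum_t F t x).
Proof.
move=> Fl; have /choice[C HC] : forall t, exists C, 0 <= C /\
    forall x y d, 0 <= d -> box r x -> box r y ->
      (forall i, `|x i - y i| <= d) -> `|F t x - F t y| <= C * d.
  by move=> t; have [C C0 H] := Fl t; exists C.
exists (\sum_t C t) => [|x y d d0 bx bY xy].
  by apply: sumr_ge0 => t _; case: (HC t).
rewrite -sumrB (le_trans (ler_norm_sum _ _ _))// mulr_suml ler_sum// => t _.
by have [_] := HC t; apply.
Qed.

End Lipschitz.

(* A ball of radius [eps] contains [m ^ #|K|] points at mutual distance
   [eps / m], whereas the images are covered by [O(m ^ (#|K| - 1))] sets of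
   smaller diameter. *)
Lemma lip_images_avoid (R : realType) (K I J : finType) (P : J -> {set I})
    (psi : J -> (I -> R) -> K -> R) (r : nat) (eps : R) :
  0 < eps -> (forall j, #|P j| < #|K|)%N ->
  (forall j k, lip r%:R (fun x => psi j x k)) ->
  exists2 c : K -> R, (forall k, 0 <= c k <= eps) &
    forall j x, box r%:R x -> (forall i, i \notin P j -> x i = 0) ->
      psi j x <> c.
Proof.
move=> eps0 PK psil.
have [C C0 psiC] : exists2 C, 0 <= C & forall j k x y d, 0 <= d ->
    box r%:R x -> box r%:R y -> (forall i, `|x i - y i| <= d) ->
    `|psi j x k - psi j y k| <= C * d.
  have /choice[C HC] : forall jk : J * K, exists C, 0 <= C /\
      forall x y d, 0 <= d -> box r%:R x -> box r%:R y ->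
      (forall i, `|x i - y i| <= d) -> `|psi jk.1 x jk.2 - psi jk.1 y jk.2| <=
        C * d.
    by case=> j k; have [C C0 H] := psil j k; exists C.
  exists (\sum_jk C jk) => [|j k x y d d0 bx bY xy].
    by apply: sumr_ge0 => t _; case: (HC t).
  have [_ H] := HC (j, k); apply: (le_trans (H x y d d0 bx bY xy)).
  rewrite ler_wpM2r// (bigD1 (j, k))//= lerDl.
  by apply: sumr_ge0 => t _; case: (HC t).
(* [C / q < eps], so two points in one cell of side [1 / (q * m)] have images closer than [eps / m],
   the spacing of the grid. *)
pose q := (Num.bound (C / eps)).
have Cq : C < eps * q%:R.
  by rewrite mulrC -ltr_pdivrMr// /q; apply: archi_boundP;
    rewrite divr_ge0// ltW.
have q0 : (0 < q)%N.
  by rewrite lt0n; apply: contraTneq Cq => ->; rewrite mulr0 -leNgt.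
(* Chosen so that the [m ^ #|K|] grid points outnumber [#|J| * ((2 * r * q + 1) * m) ^ #|K|.-1], a
   bound for the number of codes. *)
pose m := (#|J| * (2 * r * q + 1) ^ #|K|.-1 + 1)%N.
have m0 : (0 < m)%N by rewrite /m addn1.
pose grid (g : {ffun K -> 'I_m}) k : R := eps * (g k)%:R / m%:R.
have gridP g k : 0 <= grid g k <= eps.
  rewrite /grid divr_ge0 ?mulr_ge0 ?(ltW eps0)//= ler_pdivrMr ?ltr0n//.
  by rewrite ler_pM2l// ler_nat ltnW.
apply: contrapT => noc.
have /choice[w wP] : forall g : {ffun K -> 'I_m}, exists w : J * (I -> R),
    [/\ box r%:R w.2, forall i, i \notin P w.1 -> w.2 i = 0 &
        psi w.1 w.2 = grid g].
  move=> g; apply: contrapT => noj; apply: noc; exists (grid g) => //.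
  by move=> j x bx xP E; apply: noj; exists (j, x).
pose M := (2 * r * q * m)%N.
pose cell (x : I -> R) i : 'I_M.+1 :=
  inord (Num.truncn ((x i + r%:R) * (q * m)%:R)).
have cellP x y i : box r%:R x -> box r%:R y -> cell x i = cell y i ->
    `|x i - y i| <= (q * m)%:R^-1.
  have qm0 : (0 : R) < (q * m)%:R by rewrite ltr0n muln_gt0 q0.
  have aux (z : I -> R) : box r%:R z -> 0 <= (z i + r%:R) * (q * m)%:R /\
      (Num.truncn ((z i + r%:R) * (q * m)%:R) < M.+1)%N.
    move=> /(_ i); rewrite ler_norml => /andP[z1 z2].
    have z0 : 0 <= (z i + r%:R) * (q * m)%:R.
      by rewrite mulr_ge0// -lerBlDr sub0r.
    split=> //; rewrite ltnS -(ler_nat R).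
    apply: le_trans (_ : _ <= (z i + r%:R) * (q * m)%:R) _.
      by rewrite truncn_le.
    have -> : M%:R = (r%:R + r%:R) * (q * m)%:R :> R.
      by rewrite /M -mulnA !natrM; ring.
    by rewrite ler_wpM2r ?(ltW qm0)// lerD2r.
  move=> bx bY /(congr1 val); have [x0 xM] := aux x bx;
    have [y0 yM] := aux y bY.
  rewrite /= !inordK// => xy.
  have /andP[x1 x2] := truncn_itv x0; have /andP[y1 y2] := truncn_itv y0.
  rewrite -(ler_pM2r qm0) mulVf ?gt_eqF// -[X in `|_| * X](@gtr0_norm R)//
    -normrM.
  rewrite xy in x1 x2; rewrite -natr1 in x2; rewrite -natr1 in y2.
  by rewrite ler_norml; apply/andP; split; lra.
(* Coordinates outside [P j] vanish and get the dummy cell [ord0], so only [#|P j|] coordinates are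
   counted. *)
pose code g : J * {ffun I -> 'I_M.+1} :=
  ((w g).1, [ffun i => if i \in P (w g).1 then cell (w g).2 i else ord0]).
have code_inj : injective code.
  move=> g h /[dup] /(congr1 fst) /= E1 /(congr1 snd) /= /ffunP E2.
  have [bg Pg Eg] := wP g; have [bh Ph Eh] := wP h.
  have xy i : `|(w g).2 i - (w h).2 i| <= (q * m)%:R^-1.
    have := E2 i; rewrite !ffunE -E1; case: ifPn => iP; first exact: cellP.
    by rewrite Pg// Ph -?E1// subrr normr0 invr_ge0.
  apply/ffunP => k; have := psiC (w g).1 k _ _ _ _ bg bh xy.
  rewrite Eg {1}E1 Eh invr_ge0 ler0n => /(_ isT).
  rewrite /grid -mulrBl -mulrBr normrM normrM (gtr0_norm eps0) => gh.
  have {}gh : `|(g k)%:R - (h k)%:R| < 1 :> R.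
    have: eps * `|(g k)%:R - (h k)%:R| * `|m%:R^-1| < eps * 1 * m%:R^-1.
      apply: (le_lt_trans gh);
        rewrite natrM invfM mulrA ltr_pM2r ?invr_gt0 ?ltr0n//.
      by rewrite mulr1 ltr_pdivrMr ?ltr0n.
    by rewrite ger0_norm ?invr_ge0// ltr_pM2r ?invr_gt0 ?ltr0n// ltr_pM2l.
  apply/val_inj/eqP; apply: contraTT gh => /=; rewrite -leNgt.
  move: (nat_of_ord (g k)) (nat_of_ord (h k)) => a b; rewrite neq_ltn.
  case/orP => ab.
    by rewrite distrC -natrB 1?ltnW// ger0_norm// ler1n subn_gt0.
  by rewrite -natrB 1?ltnW// ger0_norm// ler1n subn_gt0.
pose D := [set u : J * {ffun I -> 'I_M.+1} |
             u.2 \in pffun_on ord0 (mem (P u.1)) predT].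
have codeD g : code g \in D.
  rewrite inE; apply/pffun_onP; split.
    by apply/fintype.subsetP => i; rewrite inE /= ffunE; case: ifP => // _;
      rewrite eqxx.
  by move=> ? _.
have cardD : (#|D| = \sum_j M.+1 ^ #|P j|)%N.
  pose good (j : J) (h : {ffun I -> 'I_M.+1}) :=
    h \in pffun_on ord0 (mem (P j)) predT.
  rewrite -sum1_card (eq_bigl (fun u => xpredT u.1 && good u.1 u.2)).
    rewrite -(pair_big_dep xpredT good (fun _ _ => 1%N)).
    by apply: eq_bigr => j _; rewrite sum1_card card_pffun_on card_ord.
  by move=> u; rewrite inE.
have : (#|{ffun K -> 'I_m}| <= #|D|)%N.
  rewrite -(card_imset predT code_inj) subset_leq_card//.
  by apply/fintype.subsetP => _ /imsetP[g _ ->].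
rewrite card_ffun card_ord cardD; apply/negP; rewrite -ltnNge.
have [j0 _|J0] := pickP (xpredT : pred J); last first.
  by rewrite big_pred0// expn_gt0 m0.
have K0 : (0 < #|K|)%N by apply: leq_trans (PK j0).
apply: leq_ltn_trans (_ : _ <= #|J| * ((2 * r * q + 1) * m) ^ #|K|.-1)%N _.
  rewrite -sum_nat_const leq_sum// => j _.
  apply: leq_trans (_ : _ <= M.+1 ^ #|K|.-1)%N _.
    by rewrite leq_pexp2l// -ltnS prednK.
  have [->|K1] := posnP #|K|.-1; first by rewrite !expn0.
  by rewrite leq_exp2r// mulnDl mul1n -addn1 leq_add2l.
rewrite expnMn mulnA -[X in (_ < _ ^ X)%N](prednK K0) expnS ltn_mul2r.
by rewrite expn_gt0 m0 /= -addn1 leqnn.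
Qed.

(* [g] is the inf-convolution of [f] with a multiple of the distance. *)
Lemma lipschitz_approx (R : realType) (X : normedModType R) (A : set X)
    (f : X -> R) (eps : R) :
  0 < eps -> compact A -> (A !=set0)%classic -> continuous f ->
  exists (g : X -> R) (L : R), [/\ 0 <= L,
    forall p, A p -> `|f p - g p| <= eps &
    forall p q, `|g p - g q| <= L * `|p - q|].
Proof.
move=> eps0 cA A0 cf.
have cf2 : continuous (fun u : X * X => f u.1 - f u.2 - eps).
  move=> u; apply: cvgB; last exact: cvg_cst.
  by apply: cvgB; apply: continuous_comp;
    [exact: cvg_fst|exact: cf|exact: cvg_snd|exact: cf].
have cd : continuous (fun u : X * X => `|u.1 - u.2|).
  move=> u; apply: cvg_norm; apply: cvgB; [exact: cvg_fst|exact: cvg_snd].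
(* On [B] the distance has a positive minimum, since an excess of at least [eps] excludes equal
   points; the greatest excess divided by this minimum serves as [L]. *)
pose B := ((A `*` A) `&` [set u : X * X | 0 <= f u.1 - f u.2 - eps])%classic.
have cB : compact B.
  apply: compact_closedI; first exact: compact_setX.
  by apply: (closed_comp _ (@closed_ge _ 0)) => u _; exact: cf2.
have [L L0 HL] : exists2 L, 0 <= L &
    forall p q, A p -> A q -> f p - f q <= eps + L * `|p - q|.
  have [B0|B0] := pselect (B !=set0)%classic; last first.
    exists 0 => // p q Ap Aq; rewrite mul0r addr0 leNgt; apply/negP => H.
    by apply: B0; exists (p, q); split => //=; rewrite subr_ge0 ltW.
  have [u uB umin] := compact_EVT_min B0 cB (continuous_subspaceT cd).
  have [v vB vmax] := compact_EVT_max B0 cB (continuous_subspaceT cf2).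
  rewrite inE in uB; rewrite inE in vB.
  have du : 0 < `|u.1 - u.2|.
    rewrite normr_gt0 subr_eq0; case: uB => _ /=; apply: contraTneq => ->.
    by rewrite subrr sub0r oppr_ge0 -ltNge.
  exists ((f v.1 - f v.2 - eps) / `|u.1 - u.2|).
    by rewrite divr_ge0//; case: vB.
  move=> p q Ap Aq; have [pq|pq] := leP (f p - f q) eps.
    by rewrite (le_trans pq)// lerDl mulr_ge0// divr_ge0//; case: vB.
  have pqB : (p, q) \in B by rewrite inE; split=> //=; rewrite subr_ge0 ltW.
  rewrite -lerBlDl mulrAC ler_pdivlMr//.
  apply: ler_pM => //; [by rewrite subr_ge0 ltW|exact: (vmax (p,
    q))|exact: (umin (p, q))].
pose S p := [set f q + L * `|p - q| | q in A]%classic.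
have [m _ mP] := compact_EVT_min A0 cA (continuous_subspaceT cf).
have infS p : has_inf (S p).
  split; first by case: A0 => q Aq; exists (f q + L * `|p - q|), q.
  exists (f m) => _ [q Aq <-]; rewrite -[f m]addr0 lerD//.
    by apply: mP; rewrite inE.
  by rewrite mulr_ge0.
exists (fun p => inf (S p)), L; split=> // [p Ap|p q].
  have h1 : inf (S p) <= f p.
    apply: ge_inf; first by case: (infS p).
    by exists p => //; rewrite subrr normr0 mulr0 addr0.
  have h2 : f p - eps <= inf (S p).
    apply: lb_le_inf; first by case: (infS p).
    move=> _ [q Aq <-]; have := HL p q Ap Aq; lra.
  rewrite ler_norml; lra.
have aux a b : inf (S a) - inf (S b) <= L * `|a - b|.
  rewrite lerBlDl -lerBlDr; apply: lb_le_inf; first by case: (infS b).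
  move=> _ [c Ac <-]; rewrite lerBlDr.
  apply: (@le_trans _ _ (f c + L * `|a - c|)).
    apply: ge_inf; first by case: (infS a).
    by exists c.
  rewrite -addrA lerD2l -mulrDr ler_wpM2l//.
  by rewrite [leRHS]addrC; apply: ler_distD.
rewrite ler_norml; apply/andP; split; last exact: aux.
by rewrite lerNl opprB distrC.
Qed.

(** Every point has a neighbourhood inside one box. Row vectors carry the compactness of products
    that [chart_separation] uses. *)
Lemma lip_row_continuous (R : realType) (I : finType) (f : (I -> R) -> R) :
  (forall r : nat, lip r%:R f) ->
  continuous (fun x : 'rV[R]_#|I| => f (fun i => x ord0 (enum_rank i))).
Proof.
move=> fl x; apply/(@cvgrPdist_le _ _ _ (nbhs x)) => e e0.
have [r rP] : exists r : nat, `|x| + 1 <= r%:R.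
  by exists (Num.bound (`|x| + 1)); apply/ltW/archi_boundP; rewrite addr_ge0.
have [C C0 fC] := fl r.
have row_le (z : 'rV[R]_#|I|) i : `|z ord0 i| <= `|z|.
  by rewrite [leRHS]/Num.norm/= mx_normrE; exact: (le_bigmax _ _ (ord0, i)).
near=> y.
(* The bound 1 keeps [y] in the box, and [C + 1] is positive even when [C = 0]. *)
have xy : `|x - y| <= Num.min 1 (e / (C + 1)).
  near: y; have /(@cvgrPdist_le _ _ _ (nbhs x)) := @cvg_id _ (nbhs x); apply.
  by rewrite lt_min ltr01 divr_gt0// ltr_wpDl.
move: xy; rewrite le_min => /andP[xy1 xyC].
have bx : box r%:R (fun i => x ord0 (enum_rank i)).
  by move=> i; rewrite (le_trans (row_le _ _))// (le_trans _ rP)// lerDl.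
have bY : box r%:R (fun i => y ord0 (enum_rank i)).
  move=> i; rewrite (le_trans (row_le _ _))// (le_trans _ rP)//.
  by rewrite -lerBlDl (le_trans (lerB_dist _ _))// distrC.
apply: (@le_trans _ _ (C * (e / (C + 1)))).
  apply: fC => //; first by rewrite divr_ge0// ?ltW// ltr_wpDl.
  by move=> i; have := row_le (x - y) (enum_rank i);
    rewrite !mxE => /le_trans; apply.
rewrite mulrA ler_pdivrMr ?ltr_wpDl// mulrC ler_pM2l//; lra.
Unshelve. all: by end_near.
Qed.

(** * General position *)

Definition dist1 (R : realType) (K : finType) (y z : K -> R) : R :=
  \sum_k `|y k - z k|.

Lemma dist1_ge0 (R : realType) (K : finType) (y z : K -> R) : 0 <= dist1 y z.
Proof. by apply: sumr_ge0. Qed.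

Lemma dist1_eq0 (R : realType) (K : finType) (y z : K -> R) :
  dist1 y z = 0 -> y = z.
Proof.
move=> /eqP; rewrite psumr_eq0// => /allP H; apply/funext => k.
by have := H k (mem_index_enum k); rewrite implyTb normr_eq0 subr_eq0 => /eqP.
Qed.

Lemma dist1C (R : realType) (K : finType) (y z : K -> R) : dist1 y z = dist1 z
  y.
Proof. by apply: eq_bigr => k _; rewrite distrC. Qed.

Lemma dist1_triangle (R : realType) (K : finType) (x y z : K -> R) :
  dist1 x z <= dist1 x y + dist1 y z.
Proof. by rewrite -big_split ler_sum// => k _; exact: ler_distD. Qed.

Lemma le_dist1 (R : realType) (K : finType) (y z : K -> R) k :
  `|y k - z k| <= dist1 y z.
Proof. by rewrite /dist1 (bigD1 k)//= lerDl sumr_ge0. Qed.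

Definition supported (R : realType) (I : finType) (P : {set I}) (x : I -> R) :=
  forall i, i \notin P -> x i = 0.

Lemma continuous_sum (R : realType) (X : topologicalType) (K : finType)
    (f : K -> X -> R) :
  (forall k, continuous (f k)) -> continuous (fun t => \sum_k f k t).
Proof.
by move=> cf t; apply: cvg_big => [|k _]; [exact: add_continuous|exact: cf].
Qed.

(** Points and parameters range over a compact product on which the distance from the chart to [f]
    is continuous and nowhere zero, hence has a positive minimum; finitely many charts admit a
    common bound. *)
Lemma chart_separation (R : realType) (X : topologicalType) (A : set X)
    (K I J : finType) (P : J -> {set I}) (phi : J -> (I -> R) -> K -> R)
    (r : nat) (f : X -> K -> R) :
  compact A -> (forall k, continuous (fun t => f t k)) ->
  (forall j k (r : nat), lip r%:R (fun x => phi j x k)) ->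
  (forall t j x, A t -> box r%:R x -> supported (P j) x -> phi j x <> f t) ->
  exists2 e, 0 < e & forall t j x, A t -> box r%:R x -> supported (P j) x ->
    e <= dist1 (phi j x) (f t).
Proof.
move=> cA cf lphi sep.
have /choice[e eP] : forall j, exists e, 0 < e /\ forall t x,
    A t -> box r%:R x -> supported (P j) x -> e <= dist1 (phi j x) (f t).
  move=> j.
  (* Coordinates outside [P j] are pinned at 0, so the supported part of the box is a product of
     compact sets. *)
  pose D (i : 'I_#|I|) : set R :=
    (if enum_val i \in P j then `[- r%:R, r%:R] else [set 0])%classic.
  pose B := [set v : 'rV[R]_#|I| | forall i, D i (v ord0 i)]%classic.
  have cB : compact B.
    by apply: rV_compact => i; rewrite /D; case: ifP => _;
      [exact: segment_compact|exact: compact_set1].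
  pose ex (v : 'rV[R]_#|I|) i := v ord0 (enum_rank i).
  pose h (u : 'rV[R]_#|I| * X) := dist1 (phi j (ex u.1)) (f u.2).
  have ch : continuous h.
    apply: continuous_sum => k u; apply: cvg_norm; apply: cvgB.
      apply: (@continuous_comp _ _ _ fst (fun v => phi j (ex v) k));
        first exact: cvg_fst.
      exact: (@lip_row_continuous _ _ (fun x => phi j x k) (fun s =>
        lphi j k s)).
    by apply: (@continuous_comp _ _ _ snd (fun t => f t k));
      [exact: cvg_snd|exact: cf].
  have exB x : box r%:R x -> supported (P j) x -> exists2 v, B v & ex v = x.
    move=> bx sx; exists (\row_i x (enum_val i)); last first.
      by apply/funext => i; rewrite /ex mxE enum_rankK.
    move=> i; rewrite /D mxE; case: ifPn => iP; last by rewrite /= sx.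
    by rewrite /= in_itv /= -ler_norml.
  have [BA0|BA0] := pselect ((B `*` A) !=set0)%classic; last first.
    exists 1; split=> // t x At bx sx; have [v Bv _] := exB x bx sx.
    by exfalso; apply: BA0; exists (v, t).
  have [u uBA umin] := compact_EVT_min BA0 (compact_setX cB cA)
    (continuous_subspaceT ch).
  rewrite inE in uBA; case: uBA => uB uA.
  exists (h u); split.
    rewrite lt_neqAle dist1_ge0 andbT eq_sym; apply/eqP => /dist1_eq0.
    apply: sep => // i.
      have := uB (enum_rank i); rewrite /D /ex; case: ifP => _ /=.
        by rewrite in_itv /= -ler_norml.
      by move->; rewrite normr0.
    move=> iP; have := uB (enum_rank i).
    by rewrite /D /ex enum_rankK (negPf iP).
  move=> t x At bx sx; have [v Bv <-] := exB x bx sx.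
  by have := umin (v, t); apply; rewrite inE.
exists (\big[Num.min/1]_j e j).
  by apply: lt_bigmin => // j _; case: (eP j).
move=> t j x At bx sx; have [_ H] := eP j.
by apply: le_trans (H t x At bx sx); exact: bigmin_le.
Qed.

Definition unit_box (R : realType) n : set ('rV[R]_n * R) :=
  [set p | cube p.1 /\ 0 <= p.2 <= 1]%classic.

Lemma compact_unit_box (R : realType) n : compact (@unit_box R n).
Proof.
have -> : @unit_box R n =
  ([set v : 'rV[R]_n | forall i, `[0, 1]%classic (v ord0 i)] `*` `[0,
    1])%classic.
  by apply/seteqP; split => -[t s] [/= h1 h2]; split => //= i;
    have := h1 i; rewrite in_itv.
apply: compact_setX; last exact: segment_compact.
by apply: (@rV_compact R n (fun=> `[0, 1]%classic)) => i;
  exact: segment_compact.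
Qed.

Lemma lipschitz_continuous (R : realType) (X : normedModType R) (g : X -> R) L :
  0 <= L -> (forall p q, `|g p - g q| <= L * `|p - q|) -> continuous g.
Proof.
move=> L0 gL x; apply/(@cvgrPdist_le _ _ _ (nbhs x)) => e e0; near=> y.
apply: (le_trans (gL _ _)); apply: (@le_trans _ _ (L * (e / (L + 1)))).
  rewrite ler_wpM2l//; near: y.
  have /(@cvgrPdist_le _ _ _ (nbhs x)) := @cvg_id _ (nbhs x); apply.
  by rewrite divr_gt0// ltr_wpDl.
rewrite mulrA ler_pdivrMr ?ltr_wpDl// mulrC ler_pM2l//; lra.
Unshelve. all: by end_near.
Qed.

Lemma bounded_on_compact (R : realType) (X : topologicalType) (A : set X)
    (K : finType) (f : X -> K -> R) :
  compact A -> (forall k, continuous (fun t => f t k)) ->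
  exists M, forall t k, A t -> `|f t k| <= M.
Proof.
move=> cA cf; have [A0|A0] := pselect (A !=set0)%classic; last first.
  by exists 0 => t k At; exfalso; apply: A0; exists t.
have cs : continuous (fun t => dist1 (f t) (fun=> 0)).
  by apply: continuous_sum => k t; apply: cvg_norm; apply: cvgB;
    [exact: cf|exact: cvg_cst].
have [t _ tmax] := compact_EVT_max A0 cA (continuous_subspaceT cs).
exists (dist1 (f t) (fun=> 0)) => u k Au.
apply: le_trans (tmax u _); last by rewrite inE.
by have := le_dist1 (f u) (fun=> 0) k; rewrite subr0.
Qed.

(** [Z] is the union of the images of the coordinate subspaces given by the [P j]. The last clause
    bounds the parameters needed for the part of [Z] in a cube; it supplies the compactness in the
    separation arguments. *)
Definition charted (R : realType) (K I J : finType) (P : J -> {set I})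
    (phi : J -> (I -> R) -> K -> R) (Z : set (K -> R)) :=
  [/\ forall j k (r : nat), lip r%:R (fun x => phi j x k),
      forall j x, supported (P j) x -> Z (phi j x) &
      forall M : R, exists r : nat, forall z, Z z -> (forall k, `|z k| <= M) ->
        exists j x, [/\ box r%:R x, supported (P j) x & phi j x = z]].

(** The images of the boxes miss a point of the unit cube, and by the last clause of [charted] they
    contain all of [Z] in that cube. *)
Lemma charted_point (R : realType) (K I J : finType) (P : J -> {set I})
    (phi : J -> (I -> R) -> K -> R) (Z : set (K -> R)) :
  charted P phi Z -> (forall j, #|P j| < #|K|)%N -> exists z, ~ Z z.
Proof.
move=> [lphi _ cover] PK; have [r rP] := cover 1.
have [c c01 avoid] := lip_images_avoid ltr01 PK (fun j k => lphi j k r).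
exists c => Zc; have [k|j [x [bx sx E]]] := rP c Zc.
  by rewrite ger0_norm; case/andP: (c01 k).
exact: (avoid j x).
Qed.

(** The parameters of a translated chart are those of the chart ([inl]), the cube coordinates
    ([Some i]) and the homotopy time ([None]). *)
Lemma lip_comp_row (R : realType) n (I : finType) (g : 'rV[R]_n * R -> R) L
    (r : R) :
  0 <= L -> (forall p q, `|g p - g q| <= L * `|p - q|) ->
  lip r (fun x : I + option 'I_n -> R =>
    g (\row_i x (inr (Some i)), x (inr None))).
Proof.
move=> L0 gL; exists L => // x y d d0 bx bY xy.
apply: (le_trans (gL _ _)); rewrite ler_wpM2l//.
rewrite [leLHS]/Num.norm/= ge_max xy andbT.
rewrite [leLHS]/Num.norm/= mx_normrE; apply/bigmax_leP; split=> // -[i j] _ /=.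
by rewrite !mxE.
Qed.

Lemma lip_inl (R : realType) (I' I : finType) (r : R) (f : (I -> R) -> R) :
  lip r f -> lip r (fun x : I + I' -> R => f (x \o inl)).
Proof.
move=> [C C0 fC]; exists C => // x y d d0 bx bY xy; apply: fC => // i.
- exact: bx.
- exact: bY.
- exact: xy.
Qed.

(** By the triangle inequality the infimum of the distances to [Z] moves by at most
    [dist1 (f a) (f b)]. *)
Lemma continuous_dist_to (R : realType) (X : topologicalType) (K : finType)
    (Z : set (K -> R)) (f : X -> K -> R) :
  (Z !=set0)%classic -> (forall k, continuous (fun t => f t k)) ->
  exists2 d : X -> R, continuous d &
    (forall t z, Z z -> d t <= dist1 z (f t)) /\
    (forall t e, (forall z, Z z -> e <= dist1 z (f t)) -> e <= d t).
Proof.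
move=> [z0 Zz0] cf.
pose S t := [set dist1 z (f t) | z in Z]%classic.
have infS t : has_inf (S t).
  split; first by exists (dist1 z0 (f t)), z0.
  by exists 0 => _ [z _ <-]; exact: dist1_ge0.
have d_le t z : Z z -> inf (S t) <= dist1 z (f t).
  by move=> Zz; apply: ge_inf; [case: (infS t)|exists z].
have le_d t e : (forall z, Z z -> e <= dist1 z (f t)) -> e <= inf (S t).
  move=> H; apply: lb_le_inf; first by case: (infS t).
  by move=> _ [z Zz <-]; exact: H.
exists (fun t => inf (S t)) => // t.
have aux a b : inf (S a) - inf (S b) <= dist1 (f a) (f b).
  rewrite lerBlDl -lerBlDr; apply: le_d => z Zz.
  rewrite lerBlDr (le_trans (d_le a z Zz))//.
  by rewrite [X in _ <= _ + X]dist1C; exact: dist1_triangle.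
have cd : continuous (fun u => dist1 (f t) (f u)).
  by apply: continuous_sum => k u; apply: cvg_norm; apply: cvgB;
    [exact: cvg_cst|exact: cf].
apply/(@cvgrPdist_le _ _ _ (nbhs t)) => e e0.
have := cd t; move/(@cvgrPdist_le _ _ _ (nbhs t)) => /(_ e e0).
apply: filterS => u; have -> : dist1 (f t) (f t) = 0.
  by apply: big1 => k _; rewrite subrr normr0.
rewrite sub0r normrN ger0_norm ?dist1_ge0// => H.
rewrite ler_norml; apply/andP; split; last exact: le_trans (aux t u) H.
by rewrite lerNl opprB (le_trans (aux u t))// dist1C.
Qed.

(* [G] is a Lipschitz approximation of [F] translated off [Z], and [lam] is 0 on
   [B] and 1 where [F] is close to [Z]. *)
Lemma general_position (R : realType) n (K I J : finType) (P : J -> {set I})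
    (phi : J -> (I -> R) -> K -> R) (Z : set (K -> R))
    (B : set ('rV[R]_n * R)) (F : 'rV[R]_n * R -> K -> R) :
  charted P phi Z -> (forall j, #|P j| + n.+1 < #|K|)%N ->
  compact B -> (B `<=` @unit_box R n)%classic ->
  (forall k, continuous (fun p => F p k)) ->
  (forall p, B p -> ~ Z (F p)) ->
  exists H : 'rV[R]_n * R -> K -> R,
    [/\ forall k, continuous (fun p => H p k),
        forall p, unit_box p -> ~ Z (H p) &
        forall p, B p -> H p = F p].
Proof.
move=> chZ PK cB BQ cF BZ.
have [Z0|Z0] := pselect (Z !=set0)%classic; last first.
  by exists F; split=> // p _ Zp; apply: Z0; exists (F p).
have [lphi phiZ cover] := chZ.
have [M MF] := bounded_on_compact (@compact_unit_box R n) cF.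
have [e e0 eP] : exists2 e, 0 < e & forall p z,
  B p -> Z z -> e <= dist1 z (F p).
  (* Points of [Z] within distance 1 of [F p] have coordinates at most [M + 1]; farther points are
     covered by taking the minimum with 1. *)
  have [r rP] := cover (M + 1).
  have [p j x Bp bx sx E|e e0 eP] := @chart_separation R _ B K I J P phi r F
    cB cF lphi.
    by apply: (BZ p Bp); rewrite -E; exact: phiZ.
  exists (Num.min e 1) => [|p z Bp Zz]; first by rewrite lt_min e0 ltr01.
  rewrite ge_min; have [z1|z1] := leP (dist1 z (F p)) 1;
    last by rewrite (ltW z1) orbT.
  have [k|j [x [bx sx <-]]] := rP z Zz; last by rewrite eP.
  rewrite -(subrK (F p k) (z k)) addrC (le_trans (ler_normD _ _))// lerD//.
    exact/MF/BQ.
  exact: le_trans (le_dist1 _ _ k) z1.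
pose N : R := #|K|%:R + 1.
have N0 : 0 < N by rewrite ltr_wpDl.
(* The errors [2 * eta] summed over [K] stay below [e / 2]; the 1 added in [N] keeps it positive
   when [K] is empty. *)
pose eta := e / (4 * N).
have eta0 : 0 < eta by rewrite divr_gt0// mulr_gt0.
have Q0 : (@unit_box R n !=set0)%classic.
  by exists (0, 0); split => [i|] /=; rewrite ?mxE lexx ler01.
have /choice[g gP] : forall k, exists gL : ('rV[R]_n * R -> R) * R,
    [/\ 0 <= gL.2,
    forall p, unit_box p -> `|F p k - gL.1 p| <= eta &
    forall p q, `|gL.1 p - gL.1 q| <= gL.2 * `|p - q|].
  move=> k; have [h [L H]] := lipschitz_approx eta0 (@compact_unit_box R n) Q0
    (cF k).
  by exists (h, L).
(* [M + 2 * eta] will bound the coordinates of [G]; [r'] is at least 1 so that the box also contains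
   the points of the cube. *)
have [r rP] := cover (M + 2 * eta).
pose r' := maxn r 1.
pose P' (j : J) : {set I + option 'I_n} :=
  [set s | if s is inl i then i \in P j else true].
have cardP' j : #|P' j| = (#|P j| + n.+1)%N.
  have -> : P' j = inl @: P j :|: inr @: [set: option 'I_n].
    apply/setP => -[i|o]; rewrite !inE.
      rewrite mem_imset; last by move=> ? ? [].
      by case: imsetP => [[? _]|] //; rewrite orbF.
    rewrite [X in _ || X]mem_imset ?inE ?orbT//; by move=> ? ? [].
  rewrite cardsU disjoint_setI0; last first.
    by rewrite finset.disjoints_subset;
      apply/fintype.subsetP => _ /imsetP[i _ ->];
      rewrite inE; apply/imsetP => -[].
  rewrite cards0 subn0 !card_imset; [|by move=> ? ? []..].
  by rewrite cardsT card_option card_ord.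
(* [psi j] takes the value [c] exactly where the translate [g + c] meets the chart [phi j]. *)
pose psi j (x : I + option 'I_n -> R) k :=
  phi j (x \o inl) k - (g k).1 (\row_i x (inr (Some i)), x (inr None)).
have [c c0 avoid] : exists2 c : K -> R, (forall k, 0 <= c k <= eta) &
    forall j x, box r'%:R x -> (forall i, i \notin P' j -> x i = 0) ->
      psi j x <> c.
  apply: lip_images_avoid => // [j|j k]; first by rewrite cardP' PK.
  have [L0 _ gL] := gP k.
  exact: (lipD (lip_inl _ (lphi j k r')) (lipN (lip_comp_row _ _ L0 gL))).
pose G p k := (g k).1 p + c k.
have GF p k : unit_box p -> `|G p k - F p k| <= 2 * eta.
  move=> Qp; have [_ H _] := gP k; have := H p Qp; have := c0 k.
  by rewrite /G !ler_norml => /andP[? ?] /andP[? ?]; apply/andP; split; lra.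
have GZ p : unit_box p -> ~ Z (G p).
  move=> Qp Zp; have [k|j [x [bx sx E]]] := rP _ Zp.
    rewrite -(subrK (F p k) (G p k)) addrC (le_trans (ler_normD _ _))// lerD//.
      exact: MF.
    exact: GF.
  pose y (s : I + option 'I_n) : R := match s with
    | inl i => x i | inr (Some i) => p.1 ord0 i | inr None => p.2 end.
  apply: (avoid j y).
  - move=> [i|[i|]] /=.
    + by rewrite (le_trans (bx i))// ler_nat leq_maxl.
    + case: Qp => /(_ i)/andP[h1 h2] _.
      by rewrite ger0_norm// (le_trans h2)// ler1n leq_max orbT.
    + case: Qp => _ /andP[h1 h2].
      by rewrite ger0_norm// (le_trans h2)// ler1n leq_max orbT.
  - by move=> [i|o]; rewrite inE //; exact: sx.
  - apply/funext => k; rewrite /psi.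
    have -> : y \o inl = x by apply/funext.
    have -> : (\row_i y (inr (Some i)), y (inr None)) = p.
      by rewrite [RHS]surjective_pairing; congr pair; apply/rowP => i;
        rewrite mxE.
    by rewrite E /G addrAC subrr add0r.
have [d cd [d_le le_d]] := continuous_dist_to Z0 cF.
(* This is 1 where [d p <= e / 2] and 0 where [d p >= e], in particular on [B]. *)
pose lam p : R := Num.max 0 (Num.min 1 (2 - 2 * d p / e)).
have lam01 p : 0 <= lam p <= 1.
  by rewrite le_max lexx/= ge_max ler01/= ge_min lexx.
exists (fun p k => F p k + lam p * (G p k - F p k)); split.
- move=> k p; apply: cvgD; first exact: cF.
  have cG : continuous (fun p => G p k).
    have [L0 _ gL] := gP k => q; apply: cvgD; last exact: cvg_cst.
    exact: lipschitz_continuous L0 gL q.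
  have clam : {for p, continuous lam}.
    apply: (@continuous_max _ _ (fun=> 0)
      (fun p => Num.min 1 (2 - 2 * d p / e))); first exact: cvg_cst.
    apply: (@continuous_min _ _ (fun=> 1) (fun p => 2 - 2 * d p / e)).
      exact: cvg_cst.
    apply: cvgB; first exact: cvg_cst.
    apply: cvgM; last exact: cvg_cst.
    by apply: cvgM; [exact: cvg_cst|exact: cd].
  by apply: cvgM; [exact: clam|apply: cvgB; [exact: cG|exact: cF]].
- move=> p Qp; have [dp|dp] := leP (d p) (e / 2).
    have -> : lam p = 1.
      have H : 1 <= 2 - 2 * d p / e.
        rewrite lerBrDr -lerBrDl ler_pdivrMr//; lra.
      by rewrite /lam (min_idPl H) (max_idPr ler01).
    rewrite (_ : (fun k => _) = G p); first exact: GZ.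
    by apply/funext => k; rewrite mul1r addrC subrK.
  (* Here the interpolated point is within [e / 2] of [F p], while [Z] is farther away than that. *)
  move=> Zp; have := d_le p _ Zp; rewrite leNgt => /negP; apply.
  apply: le_lt_trans dp.
  apply: (@le_trans _ _ (\sum_(k : K) 2 * eta)).
    apply: ler_sum => k _; rewrite addrAC subrr add0r normrM.
    rewrite -[leRHS]mul1r; apply: ler_pM => //; last exact: GF.
    by have /andP[? ?] := lam01 p; rewrite ger0_norm.
  rewrite sumr_const -[_ *+ _]mulr_natl /eta.
  have -> : #|K|%:R * (2 * (e / (4 * N))) = (#|K|%:R / N) * (e / 2) :> R.
    by field; rewrite gt_eqF.
  rewrite -[leRHS]mul1r ler_wpM2r ?divr_ge0 ?(ltW e0)//.
  by rewrite ler_pdivrMr// mul1r /N lerDl.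
- move=> p Bp; apply/funext => k.
  have -> : lam p = 0.
    have : e <= d p by apply: le_d => z Zz; exact: eP.
    move=> ed; have H : 2 - 2 * d p / e <= 0.
      rewrite subr_le0 ler_pdivlMr//; lra.
    rewrite /lam (max_idPl _)// ge_min H orbT //.
  by rewrite mul0r addr0.
Qed.

(** * Homotopy groups of the complement of a charted set *)

Lemma continuous_to_mx (T X : topologicalType) m n (M : X -> 'M[T]_(m, n)) :
  (forall i j, continuous (fun x => M x i j)) -> continuous M.
Proof.
move=> cM x A [P PM PA].
have H (ij : 'I_m * 'I_n) : nbhs x [set y | P ij.1 ij.2 (M y ij.1
  ij.2)]%classic.
  exact: (cM ij.1 ij.2 x _ (PM _ _)).
have := @filter_forall _ _ _ _ (nbhs_filter x) H.
apply: (@filterS _ _ (nbhs_filter x)) => y Hy; apply: PA => i j.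
exact: (Hy (i, j)).
Qed.

(** Precomposing with the coordinatewise retraction onto the cube makes the map continuous
    everywhere, as [general_position] asks of [F]. *)
Lemma within_cube_clamp (R : realType) n (T : topologicalType)
    (f : 'rV[R]_n -> T) :
  {within @cube R n, continuous f}%classic ->
  exists2 f' : 'rV[R]_n -> T, continuous f' & forall t, cube t -> f' t = f t.
Proof.
move=> /subspace_continuousP cf.
pose cl (x : R) : R := Num.max 0 (Num.min 1 x).
pose clamp (t : 'rV[R]_n) : 'rV[R]_n := \row_i cl (t ord0 i).
have clc : continuous cl.
  move=> x; have H : {for x, continuous (fun x : R => Num.min 1 x)}.
    apply: (@continuous_min R R (fun=> 1) (fun x => x)); first exact: cvg_cst.
    exact: cvg_id.
  by apply: (@continuous_max R R (fun=> 0) (fun x => Num.min 1 x));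
    first exact: cvg_cst.
have cube_clamp t : cube (clamp t).
  by move=> i; rewrite mxE /cl le_max lexx/= ge_max ler01/= ge_min lexx.
have clamp_cts : continuous clamp.
  apply: continuous_to_mx => i0 i; rewrite (ord1 i0).
  rewrite (_ : (fun t => _) = fun t : 'rV[R]_n => cl (t ord0 i)); last first.
    by apply/funext => t; rewrite mxE.
  move=> t; apply: (@continuous_comp _ _ _ (fun u : 'rV[R]_n => u ord0 i) cl).
    exact: coord_continuous.
  exact: clc.
exists (f \o clamp) => [t|t ct] /=.
  have := cf (clamp t) (cube_clamp t); apply: cvg_trans => A HA.
  have HA' : nbhs (clamp t) [set u | cube u -> A (f u)]%classic := HA.
  have H := clamp_cts t _ HA'.
  by apply: (@filterS _ (nbhs t) _ _ _ _ H) => u; apply.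
congr f; apply/rowP => i; rewrite mxE /cl.
by have /andP[h0 h1] := ct i; rewrite (min_idPr h1) (max_idPr h0).
Qed.

(** In the coordinates [coord] the affine homotopy between two loops stays in [S] over the boundary
    of the box; [general_position] corrects it inside and leaves the boundary values alone. *)
Lemma pi_trivial_complement (R : realType) n (T : topologicalType)
    (K I J : finType) (coord : T -> K -> R) (mk : (K -> R) -> T)
    (P : J -> {set I}) (phi : J -> (I -> R) -> K -> R) (S : set T) :
  cancel coord mk -> (forall k, continuous (fun x => coord x k)) ->
  (forall (X : topologicalType) (f : X -> K -> R),
     (forall k, continuous (fun x => f x k)) -> continuous (mk \o f)) ->
  charted P phi [set z | ~ S (mk z)]%classic ->
  (forall j, #|P j| + n.+1 < #|K|)%N -> pi_trivial R n S.
Proof.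
move=> coordK ccoord cmk chS PK; split.
  have [|z /contrapT Sz] := charted_point chS; last by exists (mk z).
  by move=> j; apply: leq_ltn_trans (PK j); exact: leq_addr.
move=> x0 Sx0 f g [cf fS f0] [cg gS g0].
have [f' cf' f'E] := within_cube_clamp cf.
have [g' cg' g'E] := within_cube_clamp cg.
(* Within the box [beta] vanishes exactly on the boundary, which is thereby closed. *)
pose beta (p : 'rV[R]_n * R) : R :=
  p.2 * (1 - p.2) * \prod_i (p.1 ord0 i * (1 - p.1 ord0 i)).
have cbeta : continuous beta.
  have csnd : continuous (fun p : 'rV[R]_n * R => p.2) by move=> p;
    exact: cvg_snd.
  move=> p; apply: cvgM.
    by apply: cvgM; [exact: csnd|apply: cvgB; [exact: cvg_cst|exact: csnd]].
  apply: cvg_big => [|i _]; first exact: mul_continuous.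
  have ci : continuous (fun p : 'rV[R]_n * R => p.1 ord0 i).
    move=> q; apply: (@continuous_comp _ _ _ fst (fun t : 'rV[R]_n =>
      t ord0 i)).
      exact: cvg_fst.
    exact: coord_continuous.
  by apply: cvgM; [exact: ci|apply: cvgB; [exact: cvg_cst|exact: ci]].
pose B := (@unit_box R n `&` [set p | beta p = 0])%classic.
have cB : compact B.
  apply: compact_closedI; first exact: compact_unit_box.
  by apply: (closed_comp _ (@closed_eq _ 0)) => p _; exact: cbeta.
have Bside t s : cube t -> s = 0 \/ s = 1 -> B (t, s).
  move=> ct s01; split; first by split=> //=; case: s01 => ->;
    rewrite lexx ler01.
  by rewrite /beta /=; case: s01 => ->; rewrite ?subrr !(mulr0,mul0r).
have Bbdry t s : cube_boundary t -> 0 <= s <= 1 -> B (t, s).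
  move=> [ct [i ti]] s01; split=> //=; rewrite /beta /= (bigD1 i)//=.
  by case: ti => ->; rewrite ?subrr !(mulr0,mul0r).
have BP p : B p -> (cube p.1 /\ (p.2 = 0 \/ p.2 = 1)) \/ cube_boundary p.1.
  case: p => t s [[ct /= _]] /= /eqP;
    rewrite /beta /= !mulf_eq0 subr_eq0 => /orP[|].
    by case/orP => /eqP E; left; split=> //; [left|right].
  move=> /eqP/eqP; rewrite prodf_seq_eq0 => /hasP[i _ /=].
  rewrite mulf_eq0 subr_eq0 => /orP[] /eqP E; right; split=> //; exists i;
    first by left.
  by right.
pose F (p : 'rV[R]_n * R) k :=
  (1 - p.2) * coord (f' p.1) k + p.2 * coord (g' p.1) k.
have cF k : continuous (fun p => F p k).
  have csnd : continuous (fun p : 'rV[R]_n * R => p.2) by move=> p;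
    exact: cvg_snd.
  have cc (h : 'rV[R]_n -> T) : continuous h ->
      continuous (fun p : 'rV[R]_n * R => coord (h p.1) k).
    move=> ch p; apply: (@continuous_comp _ _ _ (h \o fst) (fun x =>
      coord x k)).
      by apply: continuous_comp; [exact: cvg_fst|exact: ch].
    exact: ccoord.
  move=> p; apply: cvgD; apply: cvgM; [|exact: cc|exact: csnd|exact: cc].
  by apply: cvgB; [exact: cvg_cst|exact: csnd].
have F0 t : cube t -> F (t, 0) = coord (f t).
  by move=> ct; apply/funext => k; rewrite /F /= f'E// subr0 mul1r mul0r addr0.
have F1 t : cube t -> F (t, 1) = coord (g t).
  by move=> ct; apply/funext => k; rewrite /F /= g'E// subrr mul1r mul0r add0r.
have Fb t s : cube_boundary t -> F (t, s) = coord x0.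
  move=> bt; have [ct _] := bt; apply/funext => k.
  by rewrite /F /= f'E// g'E// f0// g0// -mulrDl subrK mul1r.
have FS p : B p -> ~ (~ S (mk (F p))).
  move=> /BP; case: p => t s /= [[ct [->|->]]|bt] nS; apply: nS.
  - by rewrite F0// coordK; exact: fS.
  - by rewrite F1// coordK; exact: gS.
  - by rewrite Fb// coordK.
have [|H [cH HS HB]] := general_position chS PK cB _ cF FS;
  first by move=> p [].
exists (mk \o H); split.
- by apply: continuous_subspaceT; exact: cmk.
- by move=> t s ct s01 /=; apply: contrapT; apply: HS.
- move=> t ct /=; rewrite !HB ?F0 ?F1 ?coordK//; apply: Bside => //;
  first by right.
  by left.
- by move=> t s bt s01 /=; rewrite HB ?Fb ?coordK//; exact: Bbdry.
Qed.

(** * Pivots of a subspace *)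

(** The coordinate projection onto [p], kept square so that its size does not vary with [p]. *)
Definition setmx (F : fieldType) m (p : {set 'I_m}) : 'M[F]_m :=
  diag_mx (\row_i (i \in p)%:R).

(** A matrix supported on this block squares to zero, since no index is both a row and a column of
    the block. *)
Definition pivot_supp m (p : {set 'I_m}) (i l : 'I_m) := (i \in p) && (l
  \notin p).

Lemma setmx_mulE (F : fieldType) m n (p : {set 'I_m}) (A : 'M[F]_(m, n)) i l :
  (setmx F p *m A) i l = if i \in p then A i l else 0.
Proof. by rewrite mul_diag_mx !mxE; case: ifP => _; rewrite ?mul1r ?mul0r. Qed.

Lemma setmx_mulrE (F : fieldType) m n (p : {set 'I_n}) (A : 'M[F]_(m, n)) i l :
  (A *m setmx F p) i l = if l \in p then A i l else 0.
Proof. by rewrite mul_mx_diag !mxE; case: ifP => _; rewrite ?mulr1 ?mulr0. Qed.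

Lemma mxrank_setmx_le (F : fieldType) m (p : {set 'I_m}) :
  (\rank (setmx F p) <= #|p|)%N.
Proof.
pose B : 'M[F]_(#|p|, m) := \matrix_(k, l) (l == enum_val k)%:R.
have -> : setmx F p = B^T *m B; last exact: mulmx_max_rank.
apply/matrixP => i l; rewrite !mxE.
have [ip|ip] := boolP (i \in p); last first.
  rewrite mul0rn big1// => k _; rewrite !mxE.
  by case: eqP ip => [->|]; rewrite ?enum_valP// mul0r.
rewrite (bigD1 (enum_rank_in ip i))//= !mxE enum_rankK_in// eqxx mul1r.
rewrite big1 ?addr0 1?eq_sym// => k ki; rewrite !mxE.
case: (i =P enum_val k) => [ik|_]; last by rewrite mul0r.
by case/eqP: ki; apply: enum_val_inj; rewrite enum_rankK_in.
Qed.

(** The identity is the sum of the projections onto [p] and its complement, so subadditivity of the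
    rank forces equality in [mxrank_setmx_le]. *)
Lemma mxrank_setmx (F : fieldType) m (p : {set 'I_m}) : \rank (setmx F p) =
  #|p|.
Proof.
apply/eqP; rewrite eqn_leq mxrank_setmx_le/=.
have : (\rank (1%:M : 'M[F]_m) <= \rank (setmx F p) + \rank (setmx F (~: p)))%N.
  suff -> : 1%:M = setmx F p + setmx F (~: p) by exact: mxrank_add.
  apply/matrixP => i l; rewrite !mxE inE.
  by case: (i \in p); rewrite mul0rn ?addr0 ?add0r.
rewrite mxrank1 -{1}[m]card_ord -(cardsC p) => H.
have := mxrank_setmx_le F (~: p).
by rewrite -(leq_add2l (\rank (setmx F p))) => /(leq_trans H);
  rewrite leq_add2r.
Qed.

(** The cofactors along column [i] do not involve that column, so they are those of the identity
    matrix, read off from its adjugate. *)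
Lemma det_replace_col1 (F : fieldType) r (B : 'M[F]_r) (i : 'I_r) :
  (forall c, c != i -> forall k, B k c = (k == c)%:R) -> \det B = B i i.
Proof.
move=> HB; rewrite (expand_det_col _ i) (bigD1 i)//= big1 ?addr0 => [|k ki].
  suff -> : cofactor B i i = 1 by rewrite mulr1.
  have -> : cofactor B i i = cofactor 1%:M i i.
    rewrite /cofactor; congr (_ * \det _); apply/matrixP => a b.
    by rewrite !mxE HB ?neq_lift// eq_sym neq_lift.
  by have := congr1 (fun M : 'M[F]_r => M i i) (mul_mx_adj (1%:M : 'M[F]_r));
    rewrite mul1mx det1 !mxE eqxx.
suff -> : cofactor B k i = 0 by rewrite mulr0.
have -> : cofactor B k i = cofactor 1%:M k i.
  rewrite /cofactor; congr (_ * \det _); apply/matrixP => a b.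
  by rewrite !mxE HB ?neq_lift// eq_sym neq_lift.
have := congr1 (fun M : 'M[F]_r => M i k) (mul_mx_adj (1%:M : 'M[F]_r)).
by rewrite mul1mx det1 !mxE eq_sym (negPf ki).
Qed.

(* The pivots maximise a minor of [W]; by Cramer's rule the entries of [N] are
   quotients of minors of [W] by this one. *)
Lemma pivot_form (F : fieldType) (R : realDomainType) (nu : F -> R) q m
    (W : 'M[F]_(q, m)) :
  (forall x, 0 <= nu x) -> (forall x, (nu x == 0) = (x == 0)) ->
  {morph nu : x y / x * y} ->
  exists (p : {set 'I_m}) (N : 'M[F]_m),
    [/\ forall i l, ~~ pivot_supp p i l -> N i l = 0,
        forall i l, nu (N i l) <= 1,
        (W :=: setmx F p *m (1%:M + N))%MS & #|p| = \rank W].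
Proof.
move=> nu0 nu_eq0 nuM.
have nu1 : nu 1 = 1.
  have n0 : nu 1 != 0 by rewrite nu_eq0 oner_eq0.
  by apply: (mulfI n0); rewrite -nuM !mulr1.
pose B := row_base W.
have freeB : row_full B^T by rewrite /row_full mxrank_tr -/(row_free B)
  row_base_free.
pose vol (f : {ffun 'I_(\rank W) -> 'I_m}) := nu (\det (colsub f B)).
(* A choice of independent columns, which makes the maximal minor nonzero. *)
pose f0 : {ffun 'I_(\rank W) -> 'I_m} := [ffun i => fullrankfun freeB i].
have volf0 : vol f0 != 0.
  rewrite /vol nu_eq0 -unitfE -unitmxE -unitmx_tr trmx_mxsub.
  rewrite (eq_rowsub (fullrankfun freeB)) => [|i]; last by rewrite ffunE.
  by rewrite -row_full_unit fullrowsub_full.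
have [f _ fmax] := @arg_maxP _ R _ f0 xpredT vol isT.
have volf : 0 < vol f.
  by apply: lt_le_trans (fmax f0 isT); rewrite lt_neqAle eq_sym volf0 nu0.
have Mu : colsub f B \in unitmx.
  by rewrite unitmxE unitfE -nu_eq0 gt_eqF.
(* Normalised so that the pivot columns form the identity. *)
pose W' := invmx (colsub f B) *m B.
have W'f i c : W' i (f c) = (i == c)%:R.
  have := mulVmx Mu => /matrixP/(_ i c); rewrite !mxE => <-.
  by apply: eq_bigr => k _; rewrite !mxE.
have W'le i l : nu (W' i l) <= 1.
  (* Exchanging the pivot column [f i] for [l] multiplies the minor by [W' i l]; maximality bounds
     this factor. *)
  pose g : {ffun 'I_(\rank W) -> 'I_m} := [ffun c => if c == i then l else f c].
  have detg : \det (colsub g W') = W' i l.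
    rewrite (@det_replace_col1 _ _ _ i) ?mxE ?ffunE ?eqxx// => c ci k.
    by rewrite mxE ffunE (negPf ci) W'f.
  have : vol g <= vol f := fmax g isT; rewrite /vol.
  have -> : colsub g B = colsub f B *m colsub g W'.
    by rewrite mulmx_colsub mulKVmx.
  by rewrite det_mulmx detg nuM ger_pMr.
have finj : injective f.
  move=> c d cd; have := W'f c d; rewrite -cd W'f eqxx.
  by case: eqP => // _ /eqP; rewrite oner_eq0.
pose p := f @: 'I_(\rank W).
(* As [f] is injective, the sum has a single term for [i] in [p]; it plays the part of an inverse of
   [f]. *)
pose N : 'M[F]_m := \matrix_(i, l)
  if pivot_supp p i l then \sum_(c | f c == i) W' c l else 0.
have pN c l : (setmx F p *m (1%:M + N)) (f c) l = W' c l.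
  rewrite setmx_mulE imset_f// mxE [1%:M _ _]mxE [N _ _]mxE /pivot_supp
    imset_f//=.
  have sumE : \sum_(d | f d == f c) W' d l = W' c l.
    by rewrite (eq_bigl (pred1 c)) ?big_pred1_eq// => d /=;
      rewrite (inj_eq finj).
  have [/imsetP[d _ ->]|lp] /= := boolP (l \in p).
    by rewrite addr0 W'f inj_eq.
  rewrite sumE; case: eqP lp => [<-|_ _]; first by rewrite imset_f.
  by rewrite add0r.
have WW' : (W :=: W')%MS.
  apply: eqmx_trans (eqmx_sym (eq_row_base W)) _; apply: eqmx_sym.
  by apply: eqmxMfull; rewrite row_full_unit unitmx_inv.
exists p, N; split.
- by move=> i l; rewrite mxE => /negPf ->.
- move=> i l; rewrite mxE; case: ifP => [/andP[/imsetP[c _ ->] _]|_].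
    by rewrite (eq_bigl (pred1 c)) ?big_pred1_eq// => d /=;
      rewrite (inj_eq finj).
  by have /eqP -> : nu 0 == 0 by rewrite nu_eq0.
- apply: eqmx_trans WW' _; apply/eqmxP/andP; split; apply/row_subP => i.
    suff -> : row i W' = row (f i) (setmx F p *m (1%:M + N)) by exact: row_sub.
    by apply/rowP => l; rewrite mxE [RHS]mxE pN.
  have [/imsetP[c _ ->]|ip] := boolP (i \in p).
    suff -> : row (f c) (setmx F p *m (1%:M + N)) = row c W' by exact: row_sub.
    by apply/rowP => l; rewrite mxE [RHS]mxE pN.
  suff -> : row i (setmx F p *m (1%:M + N)) = 0 by exact: sub0mx.
  by apply/rowP => l; rewrite mxE setmx_mulE (negPf ip) mxE.
- by rewrite card_imset// card_ord.
Qed.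

(** * Charts of the non-stable locus *)

Section ComplexCoordinates.
Variable R : realType.
Implicit Types z w : Cplx R.

Definition cpart (b : bool) z : R := if b then complex.Re z else complex.Im z.

Definition of_cparts (x : bool -> R) : Cplx R := Complex (x true) (x false).

Lemma of_cpartsK x b : cpart b (of_cparts x) = x b.
Proof. by case: b. Qed.

Lemma cpartK z : of_cparts (cpart^~ z) = z.
Proof. by case: z. Qed.

(** The norm of [Cplx R] is itself complex-valued; real estimates go through this modulus. *)
Definition cmod z : R := Normc.normc z.

Lemma cmod_ge0 z : 0 <= cmod z.
Proof. by case: z => a b; exact: sqrtr_ge0. Qed.

Lemma cmod_eq0 z : (cmod z == 0) = (z == 0).
Proof.
by apply/eqP/eqP => [/Normc.eq0_normc//|->]; exact: Normc.normc0.
Qed.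

Lemma cmodM : {morph cmod : z w / z * w}.
Proof. exact: Normc.normcM. Qed.

Lemma cmodD z w : cmod (z + w) <= cmod z + cmod w.
Proof. exact: le_normcD. Qed.

Lemma cmodN z : cmod (- z) = cmod z.
Proof. exact: normcN. Qed.

Lemma cmod0 : cmod 0 = 0. Proof. exact: Normc.normc0. Qed.

Lemma cmod1 : cmod 1 = 1. Proof. exact: Normc.normc1. Qed.

Lemma cmod_sum (T : finType) (f : T -> Cplx R) :
  cmod (\sum_t f t) <= \sum_t cmod (f t).
Proof.
elim/big_ind2: _ => [|a b c d ab cd|//]; first by rewrite cmod0.
by rewrite (le_trans (cmodD _ _))// lerD.
Qed.

Lemma cpart_le_cmod b z : `|cpart b z| <= cmod z.
Proof.
case: z => x y; rewrite /cmod/= -sqrtr_sqr ler_wsqrtr//.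
by case: b => /=; rewrite ?lerDl ?lerDr sqr_ge0.
Qed.

Lemma cmod_of_cparts x M : (forall b,
  `|x b| <= M) -> cmod (of_cparts x) <= M + M.
Proof.
move=> xM; have M0 : 0 <= M by apply: le_trans (xM true).
rewrite /cmod/= -[leRHS]ger0_norm ?addr_ge0// -sqrtr_sqr ler_wsqrtr//.
have aux b : x b ^+ 2 <= M ^+ 2.
  by rewrite -real_normK ?num_real// lerXn2r ?nnegrE.
rewrite (le_trans (lerD (aux true) (aux false)))//.
by rewrite sqrrD addrAC lerDl mulrn_wge0// mulr_ge0.
Qed.

Definition clip (I : finType) r (f : (I -> R) -> Cplx R) :=
  forall b, lip r (fun x => cpart b (f x)).

Lemma cpartD b z w : cpart b (z + w) = cpart b z + cpart b w.
Proof. by case: z w b => [a c] [a' c'] []. Qed.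

Lemma cpartN b z : cpart b (- z) = - cpart b z.
Proof. by case: z b => [a c] []. Qed.

Lemma cpart0 b : cpart b 0 = 0.
Proof. by case: b. Qed.

Lemma clip_cst (I : finType) r z : clip r (fun _ : I -> R => z).
Proof. by move=> b; exact: lip_cst. Qed.

Lemma clipN (I : finType) r (f : (I -> R) -> Cplx R) :
  clip r f -> clip r (fun x => - f x).
Proof.
move=> cf b; rewrite (_ : (fun x => _) = fun x => - cpart b (f x)).
  exact/lipN/cf.
by apply/funext => x; rewrite cpartN.
Qed.

Lemma clipD (I : finType) r (f g : (I -> R) -> Cplx R) :
  clip r f -> clip r g -> clip r (fun x => f x + g x).
Proof.
move=> cf cg b.
rewrite (_ : (fun x => _) = fun x => cpart b (f x) + cpart b (g x)).
  exact: lipD (cf b) (cg b).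
by apply/funext => x; rewrite cpartD.
Qed.

Lemma clipM (I : finType) r (f g : (I -> R) -> Cplx R) :
  clip r f -> clip r g -> clip r (fun x => f x * g x).
Proof.
move=> cf cg [].
  rewrite (_ : (fun x => _) = fun x => cpart true (f x) * cpart true (g x) +
    - (cpart false (f x) * cpart false (g x))).
    by apply: lipD; [|apply: lipN]; apply: lipM; try exact: cf; exact: cg.
  by apply/funext => x; case: (f x) (g x) => [a c] [a' c'].
rewrite (_ : (fun x => _) = fun x => cpart true (f x) * cpart false (g x) +
  cpart false (f x) * cpart true (g x)).
  by apply: lipD; apply: lipM; try exact: cf; exact: cg.
by apply/funext => x; case: (f x) (g x) => [a c] [a' c'].
Qed.

Lemma clip_sum (I T : finType) r (F : T -> (I -> R) -> Cplx R) :
  (forall t, clip r (F t)) -> clip r (fun x => \sum_t F t x).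
Proof.
move=> cF b; rewrite (_ : (fun x => _) = fun x => \sum_t cpart b (F t x)).
  by apply: lip_sum => t; exact: cF.
apply/funext => x.
by rewrite (big_morph (cpart b) (fun z w => cpartD b z w) (cpart0 b)).
Qed.

Lemma clip_mulmx (I : finType) r m n q (f : (I -> R) -> 'M[Cplx R]_(m, n))
    (g : (I -> R) -> 'M[Cplx R]_(n, q)) i l :
  (forall i k, clip r (fun x => f x i k)) ->
  (forall k l, clip r (fun x => g x k l)) ->
  clip r (fun x => (f x *m g x) i l).
Proof.
move=> cf cg; rewrite (_ : (fun x => _) = fun x => \sum_k f x i k * g x k l).
  by apply: clip_sum => k; exact: clipM.
by apply/funext => x; rewrite mxE.
Qed.

End ComplexCoordinates.

(** * The chart attached to a choice of pivots *)

Section Charts.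
Variables (R : realType) (Q : quiver) (v : vertex Q -> nat).
Local Notation C := (Cplx R).

(** One subset of these basis indices chooses pivots at every vertex at once. *)
Definition bidx := {j : vertex Q & 'I_(v j)}.
Definition vidx := {j : vertex Q & ('I_(v j) * 'I_(v j))%type}.
Definition aidx := {a : edge Q & ('I_(v (qtail a)) * 'I_(v (qhead a)))%type}.
Definition repidx := (aidx * bool)%type.
Definition paridx := ((vidx + aidx) * bool)%type.

Implicit Types (p : {set bidx}) (x : paridx -> R) (y : repidx -> R).

Definition piv p j : {set 'I_(v j)} := [set i | Tagged (fun j =>
  'I_(v j)) i \in p].

(** The free parameters: the pivot block of each [N], and the arrow entries outside the block that
    leads from pivots to non-pivots. The first blocks have the size of Hom^0, the excluded ones that
    of Hom^1. *)
Definition par_supp p : {set paridx} :=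
  [set u : paridx | match u.1 with
    | inl w => pivot_supp (piv p (tag w)) (tagged w).1 (tagged w).2
    | inr w => ~~ (((tagged w).1 \in piv p (qtail (tag w))) &&
                   ((tagged w).2 \notin piv p (qhead (tag w))))
    end].

Definition vmx x j : 'M[C]_(v j) := \matrix_(i, l)
  of_cparts (fun b => x (inl (Tagged _ (i, l) : vidx), b)).

Definition amx x a : 'M[C]_(v (qtail a), v (qhead a)) := \matrix_(i, l)
  of_cparts (fun b => x (inr (Tagged _ (i, l) : aidx), b)).

Definition repmx y a : 'M[C]_(v (qtail a), v (qhead a)) := \matrix_(i, l)
  of_cparts (fun b => y (Tagged _ (i, l) : aidx, b)).

Definition rep_coord (A : forall a, 'M[C]_(v (qtail a),
  v (qhead a))) : repidx -> R :=
  fun k => cpart k.2 (A (tag k.1) (tagged k.1).1 (tagged k.1).2).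

Lemma repmxK y : rep_coord (repmx y) = y.
Proof.
by apply/funext => -[[a [i l]] b]; rewrite /rep_coord mxE of_cpartsK.
Qed.

Lemma rep_coordK A a : repmx (rep_coord A) a = A a.
Proof. by apply/matrixP => i l; rewrite mxE; exact: cpartK. Qed.

(* With [N = vmx x] supported on [p * ~p], the rows of [1 + N] indexed by [p]
   span a subspace; in the bases [1 + N] the representation [chart] has matrices
   [amx x], which preserve these subspaces when [x] is supported on [par_supp
     p]. *)
Definition chart x : repidx -> R := rep_coord (fun a =>
  (1%:M - vmx x (qtail a)) *m amx x a *m (1%:M + vmx x (qhead a))).

(** Subspaces are row spaces, and maps act on the right. *)
Definition subrep_mx y (W : forall j, 'M[C]_(v j)) :=
  forall a, (W (qtail a) *m repmx y a <= W (qhead a))%MS.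

(** In a nonzero product of two entries the middle index would lie both outside and inside the
    pivots. *)
Lemma vmx_sqr0 p x j : supported (par_supp p) x -> vmx x j *m vmx x j = 0.
Proof.
move=> sx; apply/matrixP => i l; rewrite !mxE big1// => k _; rewrite !mxE.
have vmx0 a c : ~~ pivot_supp (piv p j) a c ->
    of_cparts (fun b => x (inl (Tagged _ (a, c) : vidx), b)) = 0.
  move=> ac; rewrite (_ : (fun b => _) = fun=> 0)//.
  by apply/funext => b; rewrite sx// inE.
have [kp|kp] := boolP (k \in piv p j).
  by rewrite vmx0 ?mul0r// /pivot_supp kp andbF.
by rewrite [X in _ * X]vmx0 ?mulr0// /pivot_supp (negPf kp).
Qed.

Lemma sqr0_unipotent n (N : 'M[C]_n) : N *m N = 0 ->
  (1%:M + N) *m (1%:M - N) = 1%:M /\ (1%:M - N) *m (1%:M + N) = 1%:M.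
Proof.
move=> N0; rewrite !mulmxDl !mulmxDr !mul1mx !mulmx1 !mulmxN !mulNmx N0.
by rewrite oppr0 !addr0 subrK addrK.
Qed.

(** With [1 - N] in place of an inverse, the entries of the chart are polynomials in the
    parameters. *)
Lemma lip_chart r k : lip r (fun x => chart x k).
Proof.
case: k => [[a [i l]] b].
have lv s j i' l' : clip r (fun x =>
  (if s then 1%:M - vmx x j else 1%:M + vmx x j) i' l').
  move=> b'; apply: (_ : clip r _) b'.
  have lvv : clip r (fun x => vmx x j i' l').
    move=> b'; rewrite (_ : (fun x => _) = fun x =>
      x (inl (Tagged _ (i', l') : vidx), b')).
      exact: lip_coord.
    by apply/funext => x; rewrite mxE of_cpartsK.
  case: s.
    rewrite (_ : (fun x => _) = fun x =>
      (1%:M : 'M[C]_(v j)) i' l' + - vmx x j i' l').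
      by apply: clipD; [exact: clip_cst|exact: clipN].
    by apply/funext => x; rewrite !mxE.
  rewrite (_ : (fun x => _) = fun x =>
    (1%:M : 'M[C]_(v j)) i' l' + vmx x j i' l').
    by apply: clipD; [exact: clip_cst|].
  by apply/funext => x; rewrite !mxE.
have la i' l' : clip r (fun x => amx x a i' l').
  move=> b'; rewrite (_ : (fun x => _) = fun x =>
    x (inr (Tagged _ (i', l') : aidx), b')).
    exact: lip_coord.
  by apply/funext => x; rewrite mxE of_cpartsK.
rewrite /chart/rep_coord/=; move: b; apply: (_ : clip r _).
apply: clip_mulmx => [i' k|]; last exact: (lv false).
by apply: clip_mulmx => // i'' k'; exact: (lv true).
Qed.

(** The factor [1 - N] of the chart cancels against the [1 + N] that spans the subspaces, which
    leaves a block triangular matrix preserving the coordinate subspaces of the pivots. *)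
Lemma chart_subrep p x : supported (par_supp p) x ->
  exists2 W, subrep_mx (chart x) W & forall j, \rank (W j) = #|piv p j|.
Proof.
move=> sx; exists (fun j => setmx C (piv p j) *m (1%:M + vmx x j)) => [a|j].
  rewrite rep_coordK.
  have [Nt _] := sqr0_unipotent (vmx_sqr0 (qtail a) sx).
  rewrite !mulmxA -(mulmxA (setmx _ _) (1%:M + _) (1%:M - _)) Nt mulmx1.
  (* [amx x a] has no entry in a pivot row and a non-pivot column, so projecting to the pivot
     columns changes nothing. *)
  suff -> : setmx C (piv p (qtail a)) *m amx x a =
      setmx C (piv p (qtail a)) *m amx x a *m setmx C (piv p (qhead a)).
    by rewrite -[X in (X <= _)%MS]mulmxA submxMl.
  apply/matrixP => i l; rewrite setmx_mulrE setmx_mulE.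
  case: ifPn => ip; case: ifPn => lp //;
    rewrite mxE (_ : (fun b => _) = fun=> 0)//.
  by apply/funext => b; rewrite sx// inE/= ip lp.
have [N1 N2] := sqr0_unipotent (vmx_sqr0 j sx).
rewrite mxrankMfree ?mxrank_setmx// row_free_unit.
by case: (mulmx1_unit N1).
Qed.

End Charts.

Lemma cmod_one_mx (R : realType) n (N : 'M[Cplx R]_n) (s : bool) i l :
  cmod (N i l) <= 1 ->
  cmod ((if s then 1%:M + N else 1%:M - N) i l) <= 2.
Proof.
move=> N1; have N2 : cmod ((if s then N else - N) i l) <= 1.
  by case: s => //; rewrite mxE cmodN.
have -> : (if s then 1%:M + N else 1%:M - N) = 1%:M + (if s then N else - N).
  by case: (s).
rewrite mxE (le_trans (cmodD _ _))// lerD// mxE.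
by case: eqP => _; rewrite ?mulr1n ?mulr0n ?cmod1 ?cmod0 ?ler01.
Qed.

Lemma cmod_mulmx_le (R : realType) m n q (A : 'M[Cplx R]_(m, n))
    (B : 'M[Cplx R]_(n, q)) a b i l :
  (forall i k, cmod (A i k) <= a) -> (forall k l, cmod (B k l) <= b) ->
  cmod ((A *m B) i l) <= n%:R * (a * b).
Proof.
move=> Aa Bb; rewrite mxE (le_trans (cmod_sum _))//.
apply: (@le_trans _ _ (\sum_(k < n) a * b)); last first.
  by rewrite sumr_const card_ord mulr_natl.
by apply: ler_sum => k _; rewrite cmodM ler_pM ?cmod_ge0.
Qed.

(** * Bounded parameters for the charts and their number *)

Section ChartCover.
Variables (R : realType) (Q : quiver) (v : vertex Q -> nat).
Local Notation C := (Cplx R).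

(** The radius depends on [M] but not on [y] or [W]: by [pivot_form] the entries of [1 + N] and
    [1 - N] have modulus at most 2, so conjugating [y] by them gives bounded parameters. *)
Lemma chart_cover (M : R) : exists r : nat, forall (y : repidx v -> R) W,
  subrep_mx y W -> (forall k, `|y k| <= M) ->
  exists p (x : paridx v -> R), [/\ box r%:R x, supported (par_supp p) x,
    chart x = y & forall j, #|piv p j| = \rank (W j)].
Proof.
(* Bounds the entries of [A a]: a factor 2 for each unipotent matrix, [M + M] for [repmx y a], and
   an inner dimension for each of the two products. *)
pose T a : R := (v (qhead a))%:R * ((v (qtail a))%:R * (2 * (M + M)) * 2).
exists (Num.bound (1 + \sum_a `|T a|)) => y W subW yM.
have bound_ge u : u <= 1 + \sum_a `|T a| ->
    u <= (Num.bound (1 + \sum_a `|T a|))%:R.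
  by move=> H; apply: (le_trans H); apply/ltW/archi_boundP;
    rewrite addr_ge0// sumr_ge0.
have exN : forall j, exists pN : {set 'I_(v j)} * 'M[C]_(v j),
    [/\ forall i l, ~~ pivot_supp pN.1 i l -> pN.2 i l = 0,
        forall i l, cmod (pN.2 i l) <= 1,
        (W j :=: setmx C pN.1 *m (1%:M + pN.2))%MS & #|pN.1| = \rank (W j)].
  move=> j; have [p [N H]] := pivot_form (W j) (@cmod_ge0 R) (@cmod_eq0 R)
    (@cmodM R).
  by exists (p, N).
pose pN j := sval (cid (exN j)); have HpN j := svalP (cid (exN j)).

pose p : {set bidx v} := [set u : bidx v | tagged u \in (pN (tag u)).1].
have pivE j : piv p j = (pN j).1 by apply/setP => i; rewrite !inE.
pose N j := (pN j).2.
(* The representation in the bases [1 + N]; the chart undoes this conjugation. *)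
pose A a := (1%:M + N (qtail a)) *m repmx y a *m (1%:M - N (qhead a)).
pose x (u : paridx v) : R := match u.1 with
  | inl w => cpart u.2 (N (tag w) (tagged w).1 (tagged w).2)
  | inr w => cpart u.2 (A (tag w) (tagged w).1 (tagged w).2) end.
have vx j : vmx x j = N j by apply/matrixP => i l; rewrite mxE; exact: cpartK.
have ax a : amx x a = A a.
  by apply/matrixP => i l; rewrite mxE; exact: cpartK.
have NN j : N j *m N j = 0.
  apply/matrixP => i l; rewrite !mxE big1// => k _.
  have [H _ _ _] := HpN j.
  have [kp|kp] := boolP (k \in (pN j).1).
    by rewrite /N H ?mul0r// /pivot_supp kp andbF.
  by rewrite /N [X in _ * X]H ?mulr0// /pivot_supp (negPf kp).
(* Invariance of the subspaces, multiplied by [1 - N] on the right, puts the pivot rows of [A a] in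
   the span of the pivot coordinates. *)
have Asupp a i l : i \in (pN (qtail a)).1 -> l \notin (pN (qhead a)).1 -> A a
  i l = 0.
  move=> ip lp.
  have : (setmx C (pN (qtail a)).1 *m (1%:M + N (qtail a)) *m repmx y a <=
      setmx C (pN (qhead a)).1 *m (1%:M + N (qhead a)))%MS.
    have [_ _ Wt _] := HpN (qtail a); have [_ _ Wh _] := HpN (qhead a).
    apply: submx_trans (_ : (_ <= W (qhead a))%MS) _; last by rewrite Wh.
    by apply: submx_trans (subW a); apply: submxMr; rewrite Wt.
  case/submxP => Y E; have [N1 _] := sqr0_unipotent (NN (qhead a)).
  have {}E : setmx C (pN (qtail a)).1 *m A a = Y *m setmx C (pN (qhead a)).1.
    by rewrite /A !mulmxA E -!mulmxA N1 mulmx1.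
  have := congr1 (fun B : 'M[C]_(_, _) => B i l) E.
  by rewrite setmx_mulE ip setmx_mulrE (negPf lp).
exists p, x; split.
- move=> [[[j [i l]]|[a [i l]]] b]; rewrite /x/=; apply: bound_ge;
    apply: (le_trans (cpart_le_cmod _ _)).
    have [_ H _ _] := HpN j; apply: (le_trans (H i l)).
    by rewrite lerDl sumr_ge0.
  have [_ Ht _ _] := HpN (qtail a); have [_ Hh _ _] := HpN (qhead a).
  have : cmod (A a i l) <= T a.
    apply: cmod_mulmx_le => [i' k|k l']; last first.
      exact: (@cmod_one_mx R _ (N (qhead a)) false).
    apply: cmod_mulmx_le => [i'' k'|k' l'].
      exact: (@cmod_one_mx R _ (N (qtail a)) true).
    by rewrite mxE; apply: cmod_of_cparts => b'; exact: yM.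
  move=> /le_trans; apply; apply: (le_trans (ler_norm _)).
  by rewrite (bigD1 a)//= addrCA lerDl addr_ge0// sumr_ge0.
- move=> [[[j [i l]]|[a [i l]]] b]; rewrite inE /x /=.
    by rewrite pivE => ip; have [H _ _ _] := HpN j; rewrite /N H// cpart0.
  by rewrite negbK !pivE => /andP[ip lp]; rewrite Asupp// cpart0.
- rewrite -[RHS]repmxK; apply/funext => -[[a [i l]] b];
  rewrite /chart /rep_coord/=.
  rewrite !vx ax /A; have [_ Nt] := sqr0_unipotent (NN (qtail a)).
  have [_ Nh] := sqr0_unipotent (NN (qhead a)).
  by rewrite !mulmxA Nt mul1mx -mulmxA Nh mulmx1.
- by move=> j; rewrite pivE; case: (HpN j).
Qed.

Lemma sum1_pivot m n (p : {set 'I_m}) (q : {set 'I_n}) :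
  (\sum_(u : 'I_m * 'I_n | (u.1 \in p) && (u.2 \notin q)) 1 = #|p| * (n -
    #|q|))%N.
Proof.
have -> : (n - #|q| = #|~: q|)%N by rewrite [RHS]cardsCs finset.setCK card_ord.
rewrite sum1dep_card -cardsX; apply: eq_card => u.
by rewrite !inE.
Qed.

(** Counts the entries of the blocks, twice for real and imaginary parts: the codimension of a chart
    is dim Hom^1 - dim Hom^0. Both terms are moved across to avoid truncated subtraction. *)
Lemma card_par_supp (p : {set bidx v}) :
  (#|par_supp p| + 2 * \sum_a #|piv p (qtail a)| *
       (v (qhead a) - #|piv p (qhead a)|) =
   #|{: repidx v}| + 2 * \sum_j #|piv p j| * (v j - #|piv p j|))%N.
Proof.
pose g (u : vidx v + aidx v) : bool := match u with
    | inl w => pivot_supp (piv p (tag w)) (tagged w).1 (tagged w).2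
    | inr w => ~~ (((tagged w).1 \in piv p (qtail (tag w))) &&
                   ((tagged w).2 \notin piv p (qhead (tag w))))
    end.
have -> : #|par_supp p| = (2 * \sum_(u | g u) 1)%N.
  rewrite sum1dep_card mulnC -card_bool -cardsT -cardsX; apply: eq_card => u.
  by rewrite !inE andbT.
rewrite card_prod card_bool [(#|_| * 2)%N]mulnC -!mulnDr; congr (2 * _)%N.
rewrite big_sumType/= -addnA addnC; congr addn; last first.
  rewrite -(sig_big_dep xpredT (fun j u => pivot_supp (piv p j) u.1 u.2)
    (fun _ _ => 1%N)).
  by apply: eq_bigr => j _; exact: sum1_pivot.
pose h a (u : 'I_(v (qtail a)) * 'I_(v (qhead a))) :=
  (u.1 \in piv p (qtail a)) && (u.2 \notin piv p (qhead a)).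
rewrite -(sig_big_dep xpredT (fun a u => ~~ h a u) (fun _ _ => 1%N)).
rewrite -sum1_card -(sig_big_dep xpredT (fun a _ => true) (fun _ _ => 1%N)).
rewrite -big_split/=; apply: eq_bigr => a _.
by rewrite -sum1_pivot [RHS](bigID (h a))/= addnC.
Qed.

End ChartCover.

(** * The topology of the representation space *)

(** A complex number that is positive in the partial order is real. *)
Lemma cplx_norm_le (R : realType) (z : Cplx R) (e : Cplx R) : 0 < e ->
  (`|z| <= e) = (cmod z <= complex.Re e).
Proof.
case: e => a b; rewrite ltcE /= => /andP[/eqP -> a0].
by rewrite -[`|z|]/((Normc.normc z)%:C)%C lecE /= eqxx.
Qed.

Lemma cpart_continuous (R : realType) b : continuous (@cpart R b).
Proof.
move=> z; apply/(@cvgrPdist_le _ _ _ (nbhs z)) => e e0.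
have := @cvg_id _ (nbhs z); move=> /(@cvgrPdist_le _ _ _ (nbhs z)).
have ee : (0 : Cplx R) < (e%:C)%C by rewrite ltcR.
move=> /(_ _ ee); apply: filterS => w; rewrite cplx_norm_le//= => H.
rewrite -cpartN -cpartD; exact: le_trans (cpart_le_cmod _ _) H.
Qed.

Lemma of_cparts_continuous (R : realType) (X : topologicalType)
    (f : X -> bool -> R) :
  (forall b, continuous (fun x => f x b)) ->
  continuous (fun x => of_cparts (f x)).
Proof.
move=> cf x; apply/(@cvgrPdist_le _ _ _ (nbhs x)) => e e0.
have e20 : 0 < complex.Re e / 2.
  by move: e0; rewrite ltcE => /andP[_ H]; rewrite divr_gt0.
have H b : nbhs x [set y | `|f x b - f y b| <= complex.Re e / 2]%classic.
  by have := cf b x => /(@cvgrPdist_le _ _ _ (nbhs x)) /(_ _ e20).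
have HH := @filterI _ _ (nbhs_filter x) _ _ (H true) (H false).
have : nbhs x [set y | `|of_cparts (f x) - of_cparts (f y)| <= e]%classic;
  last by [].
apply: (@filterS _ _ (nbhs_filter x) _ _ _ HH) => y [H1 H2] /=.
rewrite cplx_norm_le//.
have -> : of_cparts (f x) - of_cparts (f y) = of_cparts (fun b =>
  f x b - f y b) by [].
rewrite [leRHS]splitr; apply: (@cmod_of_cparts R (fun b => f x b - f y b));
  by case.
Qed.

Lemma initial_continuousP (S : choiceType) (T X : topologicalType) (f : S -> T)
    (g : X -> initial_topology f) :
  continuous (f \o g) -> continuous g.
Proof.
move=> cfg; apply/continuousP => A [B oB <-].
by rewrite -comp_preimage; move/continuousP: cfg; apply.
Qed.

Lemma continuous_to_prod (I : Type) (T : I -> topologicalType) (X :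
  topologicalType)
    (g : X -> prod_topology T) :
  (forall i, continuous (fun x => g x i)) -> continuous g.
Proof.
move=> cg x; apply/cvg_sup => i.
exact: (@initial_continuousP (forall i, T i) (T i) X (fun f => f i) g (cg i) x).
Qed.

Lemma continuous_lincomb (F : numFieldType) (X : topologicalType) (I : finType)
    (g : I -> X -> F) (c : I -> F) :
  (forall i, continuous (g i)) -> continuous (fun x => \sum_i g i x * c i).
Proof.
move=> cg x; apply: cvg_big => [|i _]; first exact: add_continuous.
by apply: cvgM; [exact: cg|exact: cvg_cst].
Qed.

Import passmx.

Section RepTopology.
Variables (R : realType) (Q : quiver) (V : vertex Q -> vectType (Cplx R)).
Local Notation v := (total_dimv V).
Local Notation e j := (vbasis {: V j}).

Definition rep_of (y : repidx v -> R) : Rep V := fun a =>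
  hommx (e (qtail a)) (e (qhead a)) (repmx y a).

Definition coord_of (A : Rep V) : repidx v -> R :=
  rep_coord (fun a => mxof (e (qtail a)) (e (qhead a)) (rep_map A a)).

Lemma coord_ofK : cancel coord_of rep_of.
Proof.
move=> A; apply: functional_extensionality_dep => a.
by rewrite /rep_of rep_coordK mxofK// vbasisP.
Qed.

(** The topology comes from coordinates in a basis of the Hom space, [coord_of] from matrix entries;
    the two differ by a linear change of coordinates. *)
Lemma coord_of_continuous k : continuous (fun A : Rep V => coord_of A k).
Proof.
case: k => [[a [i l]] b].
pose Bh := vbasis {: 'Hom(V (qtail a), V (qhead a))}.
have E (A : Rep V) : coord_of A (Tagged _ (i, l) : aidx v, b) =
    cpart b (\sum_k rVof Bh (rep_map A a) ord0 k *
                mxof (e (qtail a)) (e (qhead a)) Bh`_k i l).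
  rewrite /coord_of /rep_coord /=; congr cpart.
  rewrite -{1}[rep_map A a](rVofK (vbasisP _)) /vecof linear_sum.
  by rewrite summxE; apply: eq_bigr => k _; rewrite linearZ/= mxE.
rewrite (funext E) => A.
pose c k := mxof (e (qtail a)) (e (qhead a)) Bh`_k i l.
pose g k (A : Rep V) := rVof Bh (rep_map A a) ord0 k.
have cg k : continuous (g k).
  move=> B; apply: (@continuous_comp _ _ _
    (fun A : Rep V => rVof Bh (rep_map A a)) (fun u => u ord0 k));
      last exact: coord_continuous.
  apply: (@continuous_comp _ (hom_top (V (qtail a)) (V (qhead a))) _
    (fun A : Rep V => rep_map A a) (rVof Bh)).
    exact: proj_continuous.
  exact: initial_continuous.
apply: (@continuous_comp _ _ _ (fun A : Rep V =>
  \sum_k g k A * c k) (@cpart R b)).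
  exact: (@continuous_lincomb (Cplx R) (Rep V) _ g (fun k => c k) cg A).
exact: cpart_continuous.
Qed.

(** The opposite change of coordinates, through the expansion of a matrix in elementary matrices. *)
Lemma rep_of_continuous (X : topologicalType) (f : X -> repidx v -> R) :
  (forall k, continuous (fun x => f x k)) -> continuous (rep_of \o f).
Proof.
move=> cf; apply: continuous_to_prod => a; apply: initial_continuousP.
set Bh := vbasis _.
apply: continuous_to_mx => i0 k; rewrite (ord1 i0).
have E x : rVof Bh (rep_of (f x) a) ord0 k =
    \sum_il repmx (f x) a il.1 il.2 * rVof Bh
      (hommx (e (qtail a)) (e (qhead a)) (delta_mx il.1 il.2)) ord0 k.
  rewrite -(pair_bigA _ (fun i l => repmx (f x) a i l * rVof Bh
      (hommx (e (qtail a)) (e (qhead a)) (delta_mx i l)) ord0 k))/=.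
  rewrite /rep_of {1}[repmx (f x) a]matrix_sum_delta !linear_sum summxE.
  apply: eq_bigr => i _; rewrite !linear_sum summxE.
  by apply: eq_bigr => l _; rewrite !linearZ mxE.
rewrite (funext E); apply: continuous_lincomb => -[i l].
rewrite (_ : (fun x => _) = fun x =>
    of_cparts (fun b => f x (Tagged _ (i, l) : aidx v, b))).
  by apply: of_cparts_continuous => b; exact: cf.
by apply/funext => y; rewrite mxE.
Qed.

End RepTopology.

(** * The codimension of the non-stable locus *)

Lemma dim_Hom (F : fieldType) (V W : vectType F) :
  \dim {: 'Hom(V, W)} = (\dim {: V} * \dim {: W})%N.
Proof. by rewrite !dimvf. Qed.

Lemma dim_subvs (F : fieldType) (V : vectType F) (A : {vspace V}) :
  \dim {: subvs_of A} = \dim A.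
Proof. by rewrite dimvf. Qed.

Section OrthogonalProjection.
Variables (R : realType) (Q : quiver) (V : vertex Q -> vectType (Cplx R)).
Variables (herm : forall j, {dot V j for @Num.conj (Cplx R)}).
Implicit Type U : forall j, {vspace V j}.

Lemma cap_orthov0 U j : (U j :&: orthov (herm j) (U j))%VS = 0%VS.
Proof.
apply/eqP; rewrite -subv0;
  apply/subvP => u /memv_capP[uU /mem_orthovP/(_ _ uU) uu0].
by rewrite memv0 -(dnorm_eq0 (herm j)); apply/eqP.
Qed.

Lemma limg_orth_proj U j : limg (orth_proj herm U j) = U j.
Proof.
apply/vspaceP => u; apply/memv_imgP/idP => [[w _ ->]|uU]; first exact: memv_pi.
exists u; rewrite ?memvf//; apply/esym/daddv_pi_id => //; exact: cap_orthov0.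
Qed.

(** Rank-nullity: the kernel of the complementary projection is [U j]. *)
Lemma dim_limg_orth_projC U j :
  \dim (limg (orth_projC herm U j)) = (\dim {: V j} - \dim (U j))%N.
Proof.
rewrite -(limg_ker_dim (orth_projC herm U j) fullv) capfv.
suff -> : lker (orth_projC herm U j) = U j by rewrite addKn.
apply/vspaceP => u; rewrite memv_ker /orth_projC add_lfunE opp_lfunE id_lfunE
  subr_eq0.
apply/eqP/idP => [->|uU]; first exact: memv_pi.
by apply/esym/daddv_pi_id => //; exact: cap_orthov0.
Qed.

Lemma dimR_hom_pi U i j : dimR (hom_pi herm U i j) =
  (2 * (\dim (U i) * (\dim {: V j} - \dim (U j))))%N.
Proof.
by rewrite /dimR /hom_pi dim_Hom !dim_subvs limg_orth_proj dim_limg_orth_projC.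
Qed.

End OrthogonalProjection.

(** * Subspaces as row spaces *)

Section Subspaces.
Variables (F : fieldType) (V : vectType F).
Local Notation e := (vbasis {: V}).

(** The coordinates of a basis of [U] form a matrix with independent rows and the same row space. *)
Lemma mxrank_msof (U : {vspace V}) : \rank (msof e U) = \dim U.
Proof.
have eb : basis_of {: V} e := vbasisP _.
pose B : 'M[F]_(\dim U, \dim {: V}) := \matrix_k rVof e (vbasis U)`_k.
have uB u : u *m B = rVof e (\sum_k u ord0 k *: (vbasis U)`_k).
  rewrite linear_sum mulmx_sum_row; apply: eq_bigr => k _.
  by rewrite linearZ rowK.
have -> : \rank (msof e U) = \rank B.
  apply: eqmx_rank; apply/andP; split; apply/row_subP => i.
    have /coord_vbasis E : vecof e (row i (msof e U)) \in U.
      by rewrite mem_vecof// row_sub.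
    apply/submxP; exists (\row_k coord (vbasis U) k (vecof e (row i (msof e
      U)))).
    rewrite uB; under eq_bigr do rewrite mxE.
    by rewrite -E vecofK.
  by rewrite rowK -mem_vecof// rVofK// vbasis_mem// mem_nth// size_tuple.
apply/eqP; apply: inj_row_free => u; rewrite uB => /eqP;
  rewrite rVof_eq0// => /eqP u0.
have /freeP/(_ (fun k => u ord0 k) u0) H := basis_free (vbasisP U).
by apply/rowP => k; rewrite mxE.
Qed.

Lemma dim_vsof (M : 'M[F]_(\dim {: V})) : \dim (vsof e M) = \rank M.
Proof. by rewrite -mxrank_msof; apply: eqmx_rank; apply: vsofK;
  exact: vbasisP. Qed.

End Subspaces.

Section SubrepMatrices.
Variables (R : realType) (Q : quiver) (V : vertex Q -> vectType (Cplx R)).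
Local Notation v := (total_dimv V).
Local Notation e j := (vbasis {: V j}).

Lemma subrep_msof (z : repidx v -> R) (U : forall j, {vspace V j}) :
  subrep (rep_of (V := V) z) U -> subrep_mx z (fun j => msof (e j) (U j)).
Proof.
move=> sU a; apply/row_subP => i; rewrite row_mul.
rewrite -mem_vecof ?vbasisP// (vecof_mul (vbasisP {: V (qtail a)}))?vbasisP//.
apply: (subvP (sU a)); apply: memv_img.
by rewrite mem_vecof ?vbasisP// row_sub.
Qed.

Lemma subrep_vsof (z : repidx v -> R) (W : forall j, 'M[Cplx R]_(v j)) :
  subrep_mx z W -> subrep (rep_of (V := V) z) (fun j => vsof (e j) (W j)).
Proof.
move=> sW a; apply/subvP => _ /memv_imgP[u uW ->].
rewrite -rVof_sub ?vbasisP// -rVof_mul ?vbasisP//.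
apply: submx_trans (sW a); apply: submxMr.
by rewrite rVof_sub ?vbasisP.
Qed.

End SubrepMatrices.

(** * Charts indexed by destabilising pivots *)

Section NonStable.
Variables (R : realType) (Q : quiver) (V : vertex Q -> vectType (Cplx R)).
Variable alpha : vertex Q -> R.
Local Notation v := (total_dimv V).

Definition destab (k : vertex Q -> nat) : Prop :=
  dimv_lt k v /\ qslope alpha v <= qslope alpha k.

Definition piv_dimv (p : {set bidx v}) j := #|piv p j|.

(** The index set of the charts, finite as a boolean subtype of a finite type. *)
Definition destab_piv := {p : {set bidx v} | `[< destab (piv_dimv p) >]}.

(** A point of a chart preserves subspaces of destabilising dimension vector. Conversely, the pivots
    of a destabilising subrepresentation select a chart through the representation. *)
Lemma charted_nonstable :
  charted (fun p : destab_piv => par_supp (val p)) (fun=> @chart R Q v)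
    [set z | ~ Rep_stable alpha (rep_of (V := V) z)]%classic.
Proof.
split=> [p k r|[p /asboolP/= [[_ p0 pv] sl]] x sx|M].
- exact: lip_chart.
- have [W sW rW] := chart_subrep sx => st.
  have dimE : sub_dimv (fun j => vsof (vbasis {: V j}) (W j)) = piv_dimv p.
    by apply/funext => j; rewrite /sub_dimv dim_vsof rW.
  have := st _ (subrep_vsof sW); rewrite dimE => /(_ p0 pv).
  by rewrite ltNge sl.
- have [r rP] := chart_cover v M; exists r => z nst zM.
  have [U [sU U0 Uv sl]] : exists U, [/\ subrep (rep_of (V := V) z) U,
      sub_dimv U <> (fun=> 0%N), sub_dimv U <> v &
      qslope alpha v <= qslope alpha (sub_dimv U)].
    apply: contrapT => noU; apply: nst => U sU U0 Uv; rewrite ltNge;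
      apply/negP => sl.
    by apply: noU; exists U.
  have [p [x [bx sx xz px]]] := rP z _ (subrep_msof sU) zM.
  have pU : piv_dimv p = sub_dimv U.
    by apply/funext => j; rewrite /piv_dimv px mxrank_msof.
  have pd : `[< destab (piv_dimv p) >].
    apply/asboolP; rewrite pU; split=> //; split=> // j.
    by rewrite /sub_dimv /total_dimv dimvS// subvf.
  by exists (exist _ p pd), x.
Qed.

(** The codimension of each chart is one of the numbers whose infimum is [d_min]. *)
Lemma card_destab_piv (herm : forall j, {dot V j for @Num.conj (Cplx R)}) n
    (p : destab_piv) :
  (n%:R%:E < d_min herm alpha - 1)%E ->
  (#|par_supp (val p)| + n.+1 < #|{: repidx v}|)%N.
Proof.
case: p => p /= /asboolP [plt sl] n_lt.
(* The zero parameter supplies actual subspaces with the dimension vector of the pivots, as the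
   definition of [d_min] requires. *)
have [W sW rW] := @chart_subrep R Q v p (fun=> 0) (fun _ _ => erefl).
pose U j := vsof (vbasis {: V j}) (W j).
have dU j : \dim (U j) = #|piv p j| by rewrite /U dim_vsof rW.
have D0 : dimR_Hom0 herm U = (2 * \sum_j #|piv p j| * (v j - #|piv p j|))%N.
  by rewrite big_distrr; apply: eq_bigr => j _; rewrite dimR_hom_pi !dU.
have D1 : dimR_Hom1 herm U = (2 * \sum_a #|piv p (qtail a)| *
    (v (qhead a) - #|piv p (qhead a)|))%N.
  by rewrite big_distrr; apply: eq_bigr => j _; rewrite dimR_hom_pi !dU.
have : (d_min herm alpha <=
    ((dimR_Hom1 herm U)%:R - (dimR_Hom0 herm U)%:R)%:E)%E.
  apply: ereal_inf_lbound; exists (piv_dimv p), U; split=> //.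
  by apply/funext => j; exact: dU.
move=> dle; have := lt_le_trans n_lt (leeD dle (lexx _)).
(* The strict bound by the codimension minus 1 turns into [n.+1 + dimR_Hom0 < dimR_Hom1] in
   [nat]. *)
rewrite -EFinD lte_fin ltrBrDr ltrBrDr natr1 -natrD ltr_nat D0 D1 => H.
have E := card_par_supp p.
by rewrite -(ltn_add2r (2 * \sum_j #|piv p j| * (v j - #|piv p j|))) -E -addnA
  ltn_add2l.
Qed.

End NonStable.

Theorem theorem1p1 (R : realType) (Q : quiver)
    (V : vertex Q -> vectType (Cplx R))
    (herm : forall j : vertex Q, {dot V j for @Num.conj (Cplx R)})
    (alpha : vertex Q -> R)
    (v_neq0 : total_dimv V <> (fun=> 0%N))
    (deg_v : qdeg alpha (total_dimv V) = 0)
    (n : nat)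
    (n_lt : (n%:R%:E < d_min herm alpha - 1)%E) :
  pi_trivial R n (Rep_stable (V := V) alpha).
Proof.
apply: (pi_trivial_complement (@coord_ofK R Q V) (@coord_of_continuous R Q V)
  (@rep_of_continuous R Q V) (charted_nonstable V alpha)) => p.
exact: card_destab_piv n_lt.
Qed.
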